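(* Let $M\in{}^{\mathcal K}_{\mathcal K}\mathcal{YD}$ be a finite-dimensional non-simple indecomposable module. Then the Nichols algebra $\mathfrak B(M)$ is infinite-dimensional.
   Context: $\Bbbk$ is an algebraically closed field of characteristic zero and $\xi\in\Bbbk$ is a fixed primitive $4$-th root of unity. $\mathcal K$ is the $8$-dimensional Hopf algebra over $\Bbbk$ generated as an algebra by $a,b,c,d$ with relations $ab=\xi ba$, $ac=\xi ca$, $cb=bc=0$, $cd=\xi dc$, $bd=\xi db$, $ad=da$, $ad=1$, $b^2=c^2=0$, $a^2c=b$, $a^4=1$, with $\Delta(a)=a\otimes a+b\otimes c$, $\Delta(b)=a\otimes b+b\otimes d$, $\Delta(c)=c\otimes a+d\otimes c$, $\Delta(d)=c\otimes b+d\otimes d$, $\varepsilon(a)=\varepsilon(d)=1$, $\varepsilon(b)=\varepsilon(c)=0$, $\mathcal S(a)=d$, $\mathcal S(b)=\xi b$, $\mathcal S(c)=-\xi c$, $\mathcal S(d)=a$. ${}^{\mathcal K}_{\mathcal K}\mathcal{YD}$ is the category of left Yetter-Drinfeld modules over $\mathcal K$: left modules and left comodules $M$ (coaction $\delta(m)=m_{(-1)}\otimes m_{(0)}$) with $\delta(h\cdot m)=h_{(1)}m_{(-1)}\mathcal S(h_{(3)})\otimes h_{(2)}\cdot m_{(0)}$; its braiding is $c_{M,N}(m\otimes n)=m_{(-1)}\cdot n\otimes m_{(0)}$. The Nichols algebra $\mathfrak B(V)$ of $V$ is the (unique up to isomorphism) $\mathbb N$-graded braided Hopf algebra $R=\bigoplus_{n\ge0}R(n)$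 in ${}^{\mathcal K}_{\mathcal K}\mathcal{YD}$ with $R(0)\simeq\Bbbk$, $R(1)\simeq V$, $R(1)$ equal to the space of primitive elements of $R$, and $R$ generated as an algebra by $R(1)$. *)

(* Defs.v *)
From HB Require Import structures.
From mathcomp Require Import all_boot all_order all_algebra.
From mathcomp Require Import boolp.

Set Implicit Arguments.
Unset Strict Implicit.
Unset Printing Implicit Defensive.

Import GRing.Theory.
Local Open Scope ring_scope.
Local Open Scope quotient_scope.

Section Tensor.
Variables (k : fieldType) (U V : lmodType k).
Implicit Types s t : seq (U * V).

(* A formal sum of pure tensors is a list of pairs. Two of them define the same
   tensor iff no bilinear map to any vector space separates them: this is the
   quotient of the free space on U * V by the bilinearity relations. *)
Definition formal_eval (W : lmodType k) (f : U -> V -> W) s : W :=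
  \sum_(p <- s) f p.1 p.2.

Definition formal_eq s t : bool :=
  `[< forall (W : lmodType k) (f : {bilinear U -> V -> W}),
        formal_eval f s = formal_eval f t >].

Lemma formal_eqP s t :
  reflect (forall (W : lmodType k) (f : {bilinear U -> V -> W}),
             formal_eval f s = formal_eval f t) (formal_eq s t).
Proof. exact: asboolP. Qed.

Lemma formal_eq_refl : reflexive formal_eq.
Proof. by move=> s; apply/formal_eqP. Qed.

Lemma formal_eq_sym : symmetric formal_eq.
Proof. by move=> s t; apply/formal_eqP/formal_eqP => e W f; rewrite e. Qed.

Lemma formal_eq_trans : transitive formal_eq.
Proof.
move=> t s r /formal_eqP st /formal_eqP tr.
by apply/formal_eqP => W f; rewrite st.
Qed.

Canonical formal_equiv :=
  EquivRel formal_eq formal_eq_refl formal_eq_sym formal_eq_trans.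

Definition tensor := {eq_quot formal_equiv}.
HB.instance Definition _ := Choice.on tensor.

Definition tclass s : tensor := \pi_tensor s.

Lemma tclassP s t :
  tclass s = tclass t <->
  (forall (W : lmodType k) (f : {bilinear U -> V -> W}),
     formal_eval f s = formal_eval f t).
Proof.
by split=> [/eqmodP/formal_eqP|st]; last by apply/eqmodP/formal_eqP.
Qed.

Lemma formal_eval_repr s (W : lmodType k) (f : {bilinear U -> V -> W}) :
  formal_eval f (repr (tclass s)) = formal_eval f s.
Proof.
have /tclassP/(_ W f) : tclass (repr (tclass s)) = tclass s; last by [].
by rewrite /tclass reprK.
Qed.

Lemma tclassK (x : tensor) : tclass (repr x) = x.
Proof. by rewrite /tclass reprK. Qed.

Let fscale (c : k) s := [seq (c *: p.1, p.2) | p <- s].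

Let fscaleE c s (W : lmodType k) (f : {bilinear U -> V -> W}) :
  formal_eval f (fscale c s) = c *: formal_eval f s.
Proof.
rewrite /formal_eval big_map scaler_sumr; apply: eq_bigr => p _ /=.
by rewrite linearZl_LR.
Qed.

Let fcatE s t (W : lmodType k) (f : U -> V -> W) :
  formal_eval f (s ++ t) = formal_eval f s + formal_eval f t.
Proof. by rewrite /formal_eval big_cat. Qed.

Let fnilE (W : lmodType k) (f : U -> V -> W) : formal_eval f [::] = 0.
Proof. by rewrite /formal_eval big_nil. Qed.

Definition tadd (x y : tensor) : tensor := tclass (repr x ++ repr y).
Definition tscale (c : k) (x : tensor) : tensor := tclass (fscale c (repr x)).

Let tE := (formal_eval_repr, fcatE, fscaleE, fnilE).

Lemma taddA : associative tadd.
Proof. by move=> x y z; apply/tclassP => W f; rewrite !tE addrA. Qed.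

Lemma taddC : commutative tadd.
Proof. by move=> x y; apply/tclassP => W f; rewrite !tE addrC. Qed.

Lemma tadd0 : left_id (tclass [::]) tadd.
Proof.
by move=> x; rewrite -[RHS]tclassK; apply/tclassP => W f; rewrite !tE add0r.
Qed.

Lemma taddN : left_inverse (tclass [::]) (tscale (-1)) tadd.
Proof.
by move=> x; apply/tclassP => W f; rewrite !tE scaleN1r addNr.
Qed.

HB.instance Definition _ := GRing.isZmodule.Build tensor taddA taddC tadd0 taddN.

Lemma tscaleA a b (x : tensor) : tscale a (tscale b x) = tscale (a * b) x.
Proof. by apply/tclassP => W f; rewrite !tE scalerA. Qed.

Lemma tscale1 : left_id 1 tscale.
Proof.
by move=> x; rewrite -[RHS]tclassK; apply/tclassP => W f; rewrite !tE scale1r.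
Qed.

Lemma tscaleDr : right_distributive tscale +%R.
Proof. by move=> a x y; apply/tclassP => W f; rewrite !tE scalerDr. Qed.

Lemma tscaleDl (x : tensor) : {morph tscale^~ x : a b / a + b}.
Proof. by move=> a b; apply/tclassP => W f; rewrite !tE scalerDl. Qed.

HB.instance Definition _ :=
  GRing.Zmodule_isLmodule.Build k tensor tscaleA tscale1 tscaleDr tscaleDl.

Definition tens (u : U) (v : V) : tensor := tclass [:: (u, v)].

(* Extends f to the tensor product; depends on the representative of x
   unless f is bilinear. *)
Definition tlift (W : lmodType k) (f : U -> V -> W) (x : tensor) : W :=
  formal_eval f (repr x).

Lemma tens_is_bilinear :
  bilinear_for ( *:%R : k -> tensor -> tensor) *:%R tens.
Proof.
by split=> w a x y /=; apply/tclassP => W f;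
  rewrite !tE /formal_eval !big_seq1 /= ?linearPl ?linearPr.
Qed.

HB.instance Definition _ := bilinear_isBilinear.Build k U V tensor
  ( *:%R : k -> tensor -> tensor) *:%R tens tens_is_bilinear.

Lemma tlift_tens (W : lmodType k) (f : {bilinear U -> V -> W}) u v :
  tlift f (tens u v) = f u v.
Proof. by rewrite /tlift /tens formal_eval_repr /formal_eval big_seq1. Qed.

Lemma tlift_bil (W : lmodType k) (f : U -> V -> W) u v :
  bilinear_for *:%R *:%R f -> tlift f (tens u v) = f u v.
Proof.
move=> f_bil; pose F := bilinear_isBilinear.Build k U V W *:%R *:%R f f_bil.
pose g : {bilinear U -> V -> W} := HB.pack f F.
exact: (tlift_tens g).
Qed.

Lemma tlift_is_linear (W : lmodType k) (f : {bilinear U -> V -> W}) :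
  linear (tlift f).
Proof. by move=> a x y; rewrite /tlift !tE. Qed.

Lemma tens_span (x : tensor) : x = \sum_(p <- repr x) tens p.1 p.2.
Proof.
rewrite -[LHS]tclassK; elim: (repr x) => [|p s IH]; first by rewrite big_nil.
rewrite big_cons -IH; apply/tclassP => W f.
by rewrite !tE /formal_eval big_cons big_seq1.
Qed.

End Tensor.

Notation "u \ox v" := (tens u v) (at level 40, left associativity) : ring_scope.

(* Sweedler notation. *)
Notation "\sw_ ( x , y <- t ) E" := (tlift (fun x y => E) t)
  (at level 41, x name, y name, t at level 200, E at level 41,
   format "\sw_ ( x ,  y  <-  t )  E") : ring_scope.

Section Linear.
Variable k : fieldType.

Definition has_dim (n : nat) (V : lmodType k) : Prop :=
  exists f : {linear V -> 'rV[k]_n}, bijective f.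

Definition fin_dim (V : lmodType k) : Prop := exists n, has_dim n V.

Definition alg_generated (A : algType k) (X : A -> Prop) : Prop :=
  forall S : {pred A}, subalg_closed S -> (forall x, X x -> x \in S) ->
  forall x, x \in S.

Record is_coalg (C : lmodType k) (Delta : {linear C -> tensor C C})
    (eps : {linear C -> k^o}) : Prop := IsCoalg {
  coassoc : forall x,
    \sw_(x1, y <- Delta x) (\sw_(x2, x3 <- Delta y) x1 \ox (x2 \ox x3)) =
    \sw_(y, x3 <- Delta x) (\sw_(x1, x2 <- Delta y) x1 \ox (x2 \ox x3));
  counitl : forall x, \sw_(x1, x2 <- Delta x) (eps x1 : k) *: x2 = x;
  counitr : forall x, \sw_(x1, x2 <- Delta x) (eps x2 : k) *: x1 = x
}.

Definition is_antipode (A : algType k) (Delta : {linear A -> tensor A A})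
    (eps : {linear A -> k^o}) (S : {linear A -> A}) : Prop :=
  forall x, \sw_(x1, x2 <- Delta x) S x1 * x2 = (eps x : k)%:A /\
            \sw_(x1, x2 <- Delta x) x1 * S x2 = (eps x : k)%:A.

Definition tens_mul (A : algType k) (s t : tensor A A) : tensor A A :=
  \sw_(x, y <- s) (\sw_(x', y' <- t) (x * x') \ox (y * y')).

End Linear.

Record hopf_alg (k : fieldType) := HopfAlg {
  hopf_sort :> algType k;
  hDelta : {linear hopf_sort -> tensor hopf_sort hopf_sort};
  heps : {linear hopf_sort -> k^o};
  hS : {linear hopf_sort -> hopf_sort};
  hopf_coalg : is_coalg hDelta heps;
  hDelta1 : hDelta 1 = 1 \ox 1;
  hDeltaM : forall x y, hDelta (x * y) = tens_mul (hDelta x) (hDelta y);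
  heps1 : heps 1 = 1;
  hepsM : forall x y, heps (x * y) = (heps x : k) * heps y;
  hopf_antipode : is_antipode hDelta heps hS
}.

(* The listed relations leave at most the 8 monomials a^i c^j (i < 4, j < 2),
   so together with dimension 8 they are defining relations. *)
Record is_calK (k : fieldType) (xi : k) (K : hopf_alg k) (a b c d : K) : Prop :=
  IsCalK {
  calK_gen : alg_generated (fun x => [\/ x = a, x = b, x = c | x = d]);
  calK_dim : has_dim 8 K;
  calK_ab : a * b = xi *: (b * a);
  calK_ac : a * c = xi *: (c * a);
  calK_cb : c * b = 0;
  calK_bc : b * c = 0;
  calK_cd : c * d = xi *: (d * c);
  calK_bd : b * d = xi *: (d * b);
  calK_adC : a * d = d * a;
  calK_ad : a * d = 1;
  calK_bb : b ^+ 2 = 0;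
  calK_cc : c ^+ 2 = 0;
  calK_aac : a ^+ 2 * c = b;
  calK_a4 : a ^+ 4 = 1;
  calK_Delta_a : hDelta K a = a \ox a + b \ox c;
  calK_Delta_b : hDelta K b = a \ox b + b \ox d;
  calK_Delta_c : hDelta K c = c \ox a + d \ox c;
  calK_Delta_d : hDelta K d = c \ox b + d \ox d;
  calK_eps_a : heps K a = 1;
  calK_eps_b : heps K b = 0;
  calK_eps_c : heps K c = 0;
  calK_eps_d : heps K d = 1;
  calK_S_a : hS K a = d;
  calK_S_b : hS K b = xi *: b;
  calK_S_c : hS K c = - xi *: c;
  calK_S_d : hS K d = a
}.

Section YetterDrinfeld.
Variables (k : fieldType) (H : hopf_alg k).

Record yd_data (M : lmodType k) := YDData {
  act : H -> M -> M;
  coact : M -> tensor H M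
}.

Record is_yd (M : lmodType k) (Y : yd_data M) : Prop := IsYD {
  act_bilinear : bilinear_for *:%R *:%R (act Y);
  act1 : forall m, act Y 1 m = m;
  actM : forall g h m, act Y (g * h) m = act Y g (act Y h m);
  coact_linear : linear (coact Y);
  coact_counit : forall m,
    \sw_(h, m0 <- coact Y m) (heps H h : k) *: m0 = m;
  coact_coassoc : forall m,
    \sw_(h, m0 <- coact Y m) (\sw_(h1, h2 <- hDelta H h) h1 \ox (h2 \ox m0)) =
    \sw_(h, m0 <- coact Y m) (h \ox coact Y m0);
  yd_compat : forall h m,
    coact Y (act Y h m) =
    \sw_(h1, h23 <- hDelta H h) (\sw_(h2, h3 <- hDelta H h23)
      (\sw_(m1, m0 <- coact Y m) (h1 * m1 * hS H h3) \ox act Y h2 m0))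
}.

Record yd_module := YDModule {
  yd_sort :> lmodType k;
  yd_str : yd_data yd_sort;
  yd_axioms : is_yd yd_str
}.

Definition is_yd_mor (M N : lmodType k) (Y : yd_data M) (Z : yd_data N)
    (f : M -> N) : Prop :=
  [/\ linear f,
      forall h m, f (act Y h m) = act Z h (f m) &
      forall m, coact Z (f m) = \sw_(h, m0 <- coact Y m) h \ox f m0].

Definition yd_one : yd_data k^o := {|
  act := fun h c => (heps H h : k) *: c;
  coact := fun c => (1 : H) \ox c
|}.

Definition yd_tens (M N : lmodType k) (Y : yd_data M) (Z : yd_data N) :
    yd_data (tensor M N) := {|
  act := fun h t =>
    \sw_(h1, h2 <- hDelta H h) (\sw_(m, n <- t) act Y h1 m \ox act Z h2 n);
  coact := fun t =>
    \sw_(m, n <- t) (\sw_(g, m0 <- coact Y m) (\sw_(h, n0 <- coact Z n)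
      (g * h) \ox (m0 \ox n0)))
|}.

Definition braiding (M N : lmodType k) (Y : yd_data M) (Z : yd_data N)
    (t : tensor M N) : tensor N M :=
  \sw_(m, n <- t) (\sw_(h, m0 <- coact Y m) act Z h n \ox m0).

Definition is_yd_sub (M : lmodType k) (Y : yd_data M) (U : {pred M}) : Prop :=
  [/\ submod_closed U,
      forall h m, m \in U -> act Y h m \in U &
      forall m, m \in U -> exists2 s : seq (H * M),
        {in s, forall p, p.2 \in U} & coact Y m = \sum_(p <- s) p.1 \ox p.2].

Definition yd_nonzero (M : yd_module) : Prop := exists m : M, m != 0.

Definition yd_simple (M : yd_module) : Prop :=
  yd_nonzero M /\
  forall U : {pred M}, is_yd_sub (yd_str M) U -> U =i pred1 0 \/ U =i predT.

Definition yd_indecomposable (M : yd_module) : Prop :=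
  yd_nonzero M /\
  forall U W : {pred M},
    is_yd_sub (yd_str M) U -> is_yd_sub (yd_str M) W ->
    (forall m, m \in U -> m \in W -> m = 0) ->
    (forall m, exists u w, [/\ u \in U, w \in W & m = u + w]) ->
    U =i pred1 0 \/ W =i pred1 0.

(* (x (x) y)(x' (x) y') = x c(y (x) x') y' in the braided tensor square. *)
Definition braided_mul (R : algType k) (Y : yd_data R) (s t : tensor R R) :
    tensor R R :=
  \sw_(x, y <- s) (\sw_(x', y' <- t)
    (\sw_(x'', y'' <- braiding Y Y (y \ox x')) (x * x'') \ox (y'' * y'))).

Record braided_hopf := BraidedHopf {
  bh_sort :> algType k;
  bh_yd : yd_data bh_sort;
  bDelta : {linear bh_sort -> tensor bh_sort bh_sort};
  beps : {linear bh_sort -> k^o};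
  bS : {linear bh_sort -> bh_sort};
  bh_is_yd : is_yd bh_yd;
  bh_mul_mor :
    is_yd_mor (yd_tens bh_yd bh_yd) bh_yd (tlift (fun x y => x * y));
  bh_unit_mor : is_yd_mor yd_one bh_yd (fun c : k^o => (c : k)%:A);
  bDelta_mor : is_yd_mor bh_yd (yd_tens bh_yd bh_yd) bDelta;
  beps_mor : is_yd_mor bh_yd yd_one beps;
  bS_mor : is_yd_mor bh_yd bh_yd bS;
  bh_coalg : is_coalg bDelta beps;
  bDelta1 : bDelta 1 = 1 \ox 1;
  bDeltaM : forall x y, bDelta (x * y) = braided_mul bh_yd (bDelta x) (bDelta y);
  beps1 : beps 1 = 1;
  bepsM : forall x y, beps (x * y) = (beps x : k) * beps y;
  bh_antipode : is_antipode bDelta beps bS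
}.

Record is_graded (R : braided_hopf) (gr : nat -> {pred R}) : Prop := IsGraded {
  gr_sub : forall n, is_yd_sub (bh_yd R) (gr n);
  gr_sum : forall x, exists (n : nat) (f : nat -> R),
    (forall i, f i \in gr i) /\ x = \sum_(i < n) f i;
  gr_direct : forall (n : nat) (f : nat -> R), (forall i, f i \in gr i) ->
    \sum_(i < n) f i = 0 -> forall i, (i < n)%N -> f i = 0;
  gr_one : 1 \in gr 0%N;
  gr_mul : forall i j x y, x \in gr i -> y \in gr j -> x * y \in gr (i + j)%N;
  gr_Delta : forall n x, x \in gr n -> exists2 s : seq (R * R),
    {in s, forall p, exists i j, [/\ (i + j)%N = n, p.1 \in gr i & p.2 \in gr j]}
    & bDelta R x = \sum_(p <- s) p.1 \ox p.2;
  gr_eps : forall n x, (0 < n)%N -> x \in gr n -> beps R x = 0;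
  gr_S : forall n x, x \in gr n -> bS R x \in gr n
}.

Record is_nichols (V : yd_module) (R : braided_hopf) (gr : nat -> {pred R}) :
    Prop := IsNichols {
  nichols_graded : is_graded gr;
  (* As 1 lies in degree 0, R(0) ~ k means that the unit map is onto R(0). *)
  nichols0 : forall x, x \in gr 0%N <-> exists c : k, x = c%:A;
  nichols1 : exists iota : V -> R,
    [/\ is_yd_mor (yd_str V) (bh_yd R) iota, injective iota &
        forall x, x \in gr 1%N <-> exists v, x = iota v];
  nichols_prim : forall x,
    x \in gr 1%N <-> bDelta R x = x \ox 1 + 1 \ox x;
  nichols_gen : alg_generated (fun x : R => x \in gr 1%N)
}.

End YetterDrinfeld.

(* Main.v *)
Require Import Defs.
From HB Require Import structures.
From mathcomp Require Import all_boot all_order all_algebra.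
From mathcomp Require Import boolp ring.

Set Implicit Arguments.
Unset Strict Implicit.
Unset Printing Implicit Defensive.

Import GRing.Theory.
Local Open Scope ring_scope.

(** The proof separates modules by the trivial comodule.

    Write [C1] for the span of [1, g = a^2, x = a c, y = a^3 c] and [C2] for the
    span of [a, b, c, d].  As a coalgebra, [K = C1 + C2]: [C2] is a matrix
    coalgebra, [1] and [g] are group-like, and [x], [y] are skew-primitive
    between them.  So the coaction of a comodule [M] amounts to eight operators,
    one per basis element of [K], which compose according to [Delta]
    ([coef_coef]): two idempotents [p], [q] (for [1] and [g]), arrows between
    their images (for [x], [y]), and four matrix units (for [a, b, c, d]); the
    images of [p], [q] and of the two diagonal matrix units add up to [M].

    If [p] is not zero, take [v] in its image and let [w] be the image of [v]
    under the arrow of [x]: then [coact w = g (x) w] and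
    [coact v = 1 (x) v + x (x) w], so [v] is coinvariant modulo the line of [w].
    In such a situation every Nichols algebra of [M] is infinite-dimensional.
    In the braided tensor square, moving [v] past [v] has no effect up to terms
    whose second factor is [w]; hence
    [Delta (v^n) = v^n (x) 1 + n v^(n-1) (x) v + ...],
    where the second factors of the omitted terms are multiples of [w] or have
    degree at least 2 ([power_coproduct]).  In characteristic zero no power of
    [v] vanishes, and the powers have different degrees
    ([coinvariant_modulo_line_infinite]).

    If [p = 0], then [M] is semisimple.  The arrows of [x] and [y] vanish too,
    and the Yetter-Drinfeld condition for [a] and [c] becomes a list of
    commutation relations between [a], [c], [q] and the matrix units
    [A, B, C, D].  On the image of [A], the operators [a] and [Y = C c] commute,
    [a^4 = 1] and [Y^2 = (a - xi a^3) Y]; as [a - xi a^3] is invertible with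
    inverse [(a^3 + xi a) / 2], the operator [e = (a^3 + xi a) Y / 2] is
    idempotent.  Thus a linear projection onto a submodule can be averaged over
    the powers of [a], then over [e] and [1 - e], then over the matrix units
    ([invariant_projection]); the kernel of the result is a complementary
    submodule ([yd_complement]).  An indecomposable [M] is then simple. *)

(** * Tensors and finite-dimensional linear algebra *)
Lemma regular_scale (k : fieldType) (x : k) (y : k^o) : x *: y = x * y :> k.
Proof. by []. Qed.

Section TensorCalculus.
Variable k : fieldType.

Section OneFactor.
Variables (U V W : lmodType k).
Implicit Types (f : U -> V -> W) (x y : tensor U V).

Lemma tlift_linear f : bilinear_for *:%R *:%R f -> linear (tlift f).
Proof.
move=> f_bil; pose F := bilinear_isBilinear.Build k U V W *:%R *:%R f f_bil.
pose g : {bilinear U -> V -> W} := HB.pack f F.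
exact: (tlift_is_linear g).
Qed.

Lemma tlift_lin_sum f I (r : seq I) (F : I -> tensor U V) :
    bilinear_for *:%R *:%R f ->
  tlift f (\sum_(i <- r) F i) = \sum_(i <- r) tlift f (F i).
Proof.
move=> /tlift_linear f_lin.
pose g : {linear tensor U V -> W} :=
  HB.pack (tlift f) (GRing.isLinear.Build _ _ _ _ (tlift f) f_lin).
exact: (linear_sum g).
Qed.

Lemma tlift_sum_tens f I (r : seq I) (u : I -> U) (v : I -> V) :
    bilinear_for *:%R *:%R f ->
  tlift f (\sum_(i <- r) u i \ox v i) = \sum_(i <- r) f (u i) (v i).
Proof.
move=> f_bil; rewrite tlift_lin_sum //; apply: eq_bigr => i _.
exact: tlift_bil.
Qed.

(** A representative of [x] turns the value into a finite sum that is linear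
    in [t] term by term. *)
Lemma tlift_param (T : lmodType k) (F : T -> U -> V -> W) x :
  (forall u v, linear (fun t => F t u v)) -> linear (fun t => tlift (F t) x).
Proof.
move=> F_lin a s t; rewrite /tlift /formal_eval scaler_sumr -big_split /=.
by apply: eq_bigr => p _; apply: F_lin.
Qed.

End OneFactor.

Lemma bilinear_forP (U V W : lmodType k) (f : U -> V -> W) :
  (forall v, linear (fun u => f u v)) -> (forall u, linear (f u)) ->
  bilinear_for *:%R *:%R f.
Proof. by move=> f_l f_r; split. Qed.

Lemma tens_linl (U V : lmodType k) (v : V) :
  linear (fun u : U => u \ox v).
Proof. exact: linearPl. Qed.

Lemma tens_linr (U V : lmodType k) (u : U) :
  linear (fun v : V => u \ox v).
Proof. exact: linearPr. Qed.

Lemma linear_compose (U V W : lmodType k) (g : V -> W) (f : U -> V) :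
  linear g -> linear f -> linear (fun u => g (f u)).
Proof. by move=> g_lin f_lin a x y; rewrite f_lin g_lin. Qed.

Lemma scale_bilinear (U V : lmodType k) (phi : {linear U -> k^o}) :
  bilinear_for *:%R *:%R (fun (u : U) (v : V) => (phi u : k) *: v).
Proof.
apply: bilinear_forP => [v|u] a x y.
  by rewrite linearP scalerDl -scalerA.
by rewrite scalerDr !scalerA mulrC.
Qed.

End TensorCalculus.
Arguments scale_bilinear {k U V} phi.

Section FiniteDimension.
Variables (k : fieldType) (V : lmodType k).
Hypothesis V_fin : fin_dim V.

(** A predicate closed under linear combinations is turned into the row space
    of a matrix of maximal rank among those whose rows satisfy it; the matrix
    projections onto row spaces are then available. *)
Lemma linear_projection (U : {pred V}) : submod_closed U ->
  exists pi : {linear V -> V},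
    (forall v, pi v \in U) /\ (forall u, u \in U -> pi u = u).
Proof.
move=> [U0 U_lin]; have [n [f [g fK gK]]] := V_fin.
have gL : linear g by exact: can2_linear fK gK.
pose G : {linear 'rV_n -> V} :=
  HB.pack g (GRing.isLinear.Build _ _ _ _ g gL).
have U_sum I (r : seq I) (F : I -> V) (x : I -> k) :
    (forall i, F i \in U) -> \sum_(i <- r) x i *: F i \in U.
  move=> FU; elim/big_ind: _ => // [u v uU vU|i _].
    by rewrite -[u]scale1r U_lin.
  by rewrite -[_ *: _]addr0 U_lin.
pose good m := `[< exists2 X : 'M[k]_n, (forall i, g (row i X) \in U)
                      & \rank X = m >].
have good_ex : exists m, good m.
  exists 0%N; apply/asboolP; exists 0; last by rewrite mxrank0.
  by move=> i; rewrite row0 -[g 0]/(G 0) linear0.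
have good_le m : good m -> (m <= n)%N.
  by move=> /asboolP[X _ <-]; apply: rank_leq_row.
have [m /asboolP[X XU Xm] m_max] := ex_maxnP good_ex good_le.
have inX u : (u <= X)%MS -> g u \in U.
  move=> /submxP[D ->]; rewrite mulmx_sum_row -[g _]/(G _) linear_sum.
  by under eq_bigr do rewrite linearZ; apply: U_sum.
have XinU v : v \in U -> (f v <= X)%MS.
  move=> vU; apply: contraT => vX.
  pose Y := (X + f v)%MS.
  have: good (\rank Y).
    apply/asboolP; exists Y => // i; have: (row i Y <= Y)%MS by apply: row_sub.
    rewrite /Y; case/sub_addsmxP=> -[/= D E ->].
    have -> : g (D *m X + E *m f v) = G (D *m X) + G (E *m f v).
      by rewrite -linearD.
    rewrite -[G (D *m X)]scale1r U_lin //; first by rewrite inX ?submxMl.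
    rewrite (mx11_scalar E) mul_scalar_mx linearZ /= fK -[_ *: _]addr0.
    by rewrite U_lin.
  move=> /m_max; rewrite -Xm leqNgt => /negP[].
  by rewrite (ltn_leqif (mxrank_leqif_sup _)) ?addsmxSl //
    addsmx_sub submx_refl.
pose P := proj_mx <<X>>%MS (X^C)%MS.
have XC0 : (<<X>> :&: X^C)%MS = 0.
  by apply/eqP; rewrite -submx0 (cap_eqmx (genmxE X) (eqmx_refl _)) capmx_compl.
pose p v := g (f v *m P).
have pL : linear p.
  by move=> x u v; rewrite /p linearP mulmxDl -scalemxAl -[g _]/(G _) linearP.
pose pi : {linear V -> V} :=
  HB.pack p (GRing.isLinear.Build _ _ _ _ p pL).
exists pi; split=> [v|u uU] /=.
  by apply: inX; apply: submx_trans (proj_mx_sub _ _ _) _; rewrite genmxE.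
by rewrite /p proj_mx_id ?fK // genmxE XinU.
Qed.

Lemma separating_functional (U : {pred V}) v : submod_closed U -> v \notin U ->
  exists phi : {linear V -> k^o},
    (forall u, u \in U -> phi u = 0) /\ phi v = 1.
Proof.
move=> U_sub vU; have [pi [piU pi_id]] := linear_projection U_sub.
have [n [f [g fK _]]] := V_fin.
have vd : f (v - pi v) != 0.
  rewrite -[0](linear0 f) (can_eq fK) subr_eq0; apply: contraNneq vU => ->.
  exact: piU.
have [j vj] := rV0Pn _ vd.
pose phi u : k^o := (f (v - pi v) 0 j)^-1 * f (u - pi u) 0 j.
have phiL : linear phi.
  move=> x u w; rewrite /phi linearP opprD addrACA -scalerBr linearP !mxE.
  by rewrite mulrDr mulrCA.
pose phi' : {linear V -> k^o} :=
  HB.pack phi (GRing.isLinear.Build _ _ _ _ phi phiL).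
exists phi'; split=> [u uU|] /=; last by rewrite /phi mulVf.
by rewrite /phi (pi_id u) // subrr linear0 mxE mulr0.
Qed.

(** Reduces an identity between linear combinations to an identity in the
    field, where [ring] and [field] apply. *)
Lemma vector_eq_by_coordinates (u v : V) :
  (forall phi : {linear V -> k^o}, phi u = phi v) -> u = v.
Proof.
move=> uv; apply: contrapT => /eqP; rewrite -subr_eq0 => d0.
have [||phi [_ /eqP]] := @separating_functional [pred w | w == 0] (u - v).
- by split=> [|x y z]; rewrite !inE // => /eqP-> /eqP->; rewrite scaler0 addr0.
- by rewrite inE.
by rewrite linearB uv subrr eq_sym oner_eq0.
Qed.

(** A single length works for all sequences, so a sequence that satisfies no
    nontrivial relation contradicts finite dimension. *)
Lemma free_sequence_bounded :
  exists m, forall x : nat -> V, exists u : 'rV[k]_m,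
    u != 0 /\ \sum_(i < m) u 0 i *: x i = 0.
Proof.
have [n [f [g fK _]]] := V_fin; exists n.+1 => x.
pose X := \matrix_(i < n.+1) f (x i).
have : kermx X != 0.
  by rewrite kermx_eq0 /row_free neq_ltn ltnS rank_leq_col.
case/rowV0Pn => u /sub_kermxP uX u0; exists u; split=> //.
apply: (can_inj fK); rewrite linear0 -uX mulmx_sum_row linear_sum.
by apply: eq_bigr => i _; rewrite linearZ rowK.
Qed.

End FiniteDimension.

(** A spanning family of the right cardinality is a basis.  Indexing by [nat]
    and summing over [iota 0 n] lets sums over a concrete basis unfold by
    computation. *)
Lemma dual_basis (k : fieldType) (V : lmodType k) n (e : nat -> V) :
    has_dim n V ->
    (forall x, exists u : nat -> k, x = \sum_(i <- iota 0 n) u i *: e i) ->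
  exists eps : nat -> {linear V -> k^o},
    (forall i j, (i < n)%N -> (j < n)%N -> eps i (e j) = (i == j)%:R) /\
    (forall x, x = \sum_(i <- iota 0 n) (eps i x : k) *: e i).
Proof.
move=> [f [g fK gK]] e_span.
have sumE (F : nat -> V) : \sum_(i <- iota 0 n) F i = \sum_(i < n) F i.
  by rewrite -(big_mkord xpredT) /index_iota subn0.
pose E := \matrix_(i < n) f (e i).
have fE (u : nat -> k) :
    f (\sum_(i <- iota 0 n) u i *: e i) = (\row_(i < n) u i) *m E.
  rewrite sumE linear_sum mulmx_sum_row; apply: eq_bigr => i _.
  by rewrite linearZ rowK mxE.
have E_unit : E \in unitmx.
  rewrite -row_full_unit -sub1mx; apply/row_subP => i.
  have [u u_eq] := e_span (g (row i 1%:M)).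
  by rewrite -(gK (row i 1%:M)) u_eq fE submxMl.
pose co i x : k^o := if insub i is Some j then (f x *m invmx E) 0 j else 0.
have co_lin i : linear (co i).
  move=> x u v; rewrite /co; case: insub => [j|]; last by rewrite scaler0 addr0.
  by rewrite linearP mulmxDl -scalemxAl !mxE.
pose eps i : {linear V -> k^o} :=
  HB.pack (co i) (GRing.isLinear.Build _ _ _ _ _ (co_lin i)).
exists eps; split=> [i j i_n j_n|x].
  rewrite /= /co; case: insubP => [i' _ <-|]; last by rewrite i_n.
  have -> : f (e j) = row (Ordinal j_n) E by rewrite rowK.
  by rewrite -row_mul mulmxV // row1 mxE eqxx.
apply: (can_inj fK); rewrite fE -[LHS](mulmxKV E_unit); congr (_ *m _).
by apply/rowP => i; rewrite [RHS]mxE /= /co valK.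
Qed.

(** * The braided tensor square *)
Section BraidedProduct.
Variables (k : fieldType) (H : hopf_alg k) (R : braided_hopf H).
Notation Y := (bh_yd R).
Notation action := (act Y).
Notation coaction := (coact Y).

Let act_linl (m : R) : linear (fun h => action h m) :=
  (act_bilinear (bh_is_yd R)).1 m.
Let act_linr (h : H) : linear (action h) :=
  (act_bilinear (bh_is_yd R)).2 h.
Let coactL : linear coaction := coact_linear (bh_is_yd R).

Let mul_linl (y : R) : linear (fun x : R => x * y).
Proof. by move=> a u v; rewrite mulrDl scalerAl. Qed.

Let mul_linr (x : R) : linear (fun y : R => x * y).
Proof. by move=> a u v; rewrite mulrDr scalerAr. Qed.

Let braid_bil (n : R) :
  bilinear_for *:%R *:%R (fun h (m0 : R) => action h n \ox m0).
Proof.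
apply: bilinear_forP => [v|u]; last exact: tens_linr.
exact: (linear_compose (@tens_linl _ _ _ v)).
Qed.

Let braiding_bil : bilinear_for *:%R *:%R
  (fun m n : R => \sw_(h, m0 <- coaction m) action h n \ox m0).
Proof.
apply: bilinear_forP => [n|m].
  exact: linear_compose (tlift_linear (@braid_bil n)) coactL.
apply: (@tlift_param _ _ _ _ _ (fun n h m0 => action h n \ox m0)) => u v.
exact: (linear_compose (@tens_linl _ _ _ v)).
Qed.

Lemma braiding_pure (q p : R) :
  braiding Y Y (q \ox p) = \sw_(h, m0 <- coaction q) action h p \ox m0.
Proof. exact: tlift_bil braiding_bil. Qed.

Let last_bil (x y' : R) : bilinear_for *:%R *:%R
  (fun x'' y'' : R => (x * x'') \ox (y'' * y')).
Proof.
by apply: bilinear_forP => [v|u];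
  [apply: (linear_compose (@tens_linl _ _ _ _))
  |apply: (linear_compose (@tens_linr _ _ _ _))].
Qed.

Notation prod4 x y x' y' := (\sw_(x'', y'' <- braiding Y Y (y \ox x'))
  (x * x'') \ox (y'' * y')).

Let braiding_linear : linear (braiding Y Y).
Proof. exact: tlift_linear braiding_bil. Qed.

Let inner_bil (x y : R) :
  bilinear_for *:%R *:%R (fun x' y' : R => prod4 x y x' y').
Proof.
apply: bilinear_forP => [y'|x'].
  apply: (linear_compose (tlift_linear (@last_bil x y'))).
  by apply: (linear_compose braiding_linear); apply: tens_linr.
apply: (@tlift_param _ _ _ _ _ (fun y' x'' y'' => (x * x'') \ox (y'' * y'))).
by move=> u v; apply: (linear_compose (@tens_linr _ _ _ _)).
Qed.

Let outer_bil (t : tensor R R) : bilinear_for *:%R *:%R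
  (fun x y : R => \sw_(x', y' <- t) prod4 x y x' y').
Proof.
apply: bilinear_forP => [y|x].
  apply: (@tlift_param _ _ _ _ _ (fun x x' y' => prod4 x y x' y')) => x' y'.
  apply: (@tlift_param _ _ _ _ _ (fun x x'' y'' => (x * x'') \ox (y'' * y'))).
  by move=> u v; apply: (linear_compose (@tens_linl _ _ _ _)).
apply: (@tlift_param _ _ _ _ _ (fun y x' y' => prod4 x y x' y')) => x' y'.
apply: (linear_compose (tlift_linear (@last_bil x y'))).
by apply: (linear_compose braiding_linear); apply: tens_linl.
Qed.

Lemma braided_mul_linl (t : tensor R R) : linear (fun s => braided_mul Y s t).
Proof. exact: tlift_linear (outer_bil t). Qed.

Lemma braided_mul_linr (s : tensor R R) : linear (braided_mul Y s).
Proof.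
apply: (@tlift_param _ _ _ _ _
  (fun t x y => \sw_(x', y' <- t) prod4 x y x' y')) => x y.
exact: tlift_linear (inner_bil x y).
Qed.

Lemma braided_mul_pure (p q p' q' : R) (s : seq (H * R)) :
  coaction q = \sum_(z <- s) z.1 \ox z.2 ->
  braided_mul Y (p \ox q) (p' \ox q') =
  \sum_(z <- s) (p * action z.1 p') \ox (z.2 * q').
Proof.
move=> q_co; rewrite /braided_mul tlift_bil; last exact: outer_bil.
rewrite tlift_bil; last exact: inner_bil.
rewrite braiding_pure q_co tlift_sum_tens; last exact: braid_bil.
by rewrite tlift_sum_tens //; apply: last_bil.
Qed.

(** The unit map is a morphism of modules, so [1] crosses any element without
    braiding. *)
Lemma braided_mul_one_right (p q q' : R) :
  braided_mul Y (p \ox q) (1 \ox q') = p \ox (q * q').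
Proof.
have [s /esym q_co] : exists s : seq (H * R),
    \sum_(z <- s) z.1 \ox z.2 = coaction q.
  by exists (repr (coaction q)); rewrite -tens_span.
have act_one h : action h 1 = (heps H h : k)%:A.
  have [_ /(_ h 1)] := bh_unit_mor R; rewrite /= !scale1r => <- _.
  by rewrite /= -[in RHS](mulr1 (heps H h)).
have := coact_counit (bh_is_yd R) q; rewrite q_co tlift_sum_tens; last first.
  exact: scale_bilinear.
rewrite (braided_mul_pure _ _ _ q_co) => q_eq; rewrite -[in RHS]q_eq.
rewrite mulr_suml linear_sumr; apply: eq_bigr => z _ /=.
by rewrite act_one -scalerAr mulr1 -scalerAl linearZl_LR linearZr_LR.
Qed.

End BraidedProduct.

(** * Powers of an element that is coinvariant modulo a line *)
Section CoinvariantModuloLine.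
Variables (k : fieldType) (H : hopf_alg k) (R : braided_hopf H).
Variables (gr : nat -> {pred R}) (R_graded : is_graded gr).
Variables (v w : R) (g h : H).
Hypotheses (v_deg : v \in gr 1%N) (w_deg : w \in gr 1%N).
Hypothesis v_prim : bDelta R v = v \ox 1 + 1 \ox v.
Hypothesis w_co : coact (bh_yd R) w = g \ox w.
Hypothesis v_co : coact (bh_yd R) v = 1 \ox v + h \ox w.
Notation Y := (bh_yd R).

Definition second_factor_negligible (t : tensor R R) : Prop :=
  exists2 s : seq (R * R),
    {in s, forall z, z.2 = w \/ exists2 j, (1 < j)%N & z.2 \in gr j}
    & t = \sum_(z <- s) z.1 \ox z.2.

Notation negligible := second_factor_negligible.

Let negligible0 : negligible 0.
Proof. by exists [::]; rewrite ?big_nil. Qed.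

Let negligibleD s t : negligible s -> negligible t -> negligible (s + t).
Proof.
move=> [s' s's ->] [t' t't ->]; exists (s' ++ t'); last by rewrite big_cat.
by move=> z; rewrite mem_cat => /orP[/s's|/t't].
Qed.

Let negligible_sum (I : eqType) (r : seq I) (F : I -> tensor R R) :
  {in r, forall i, negligible (F i)} -> negligible (\sum_(i <- r) F i).
Proof.
by move=> rF; rewrite big_seq; elim/big_ind: _ => // i ir; apply: rF.
Qed.

Let negligible_tens x y :
  y = w \/ (exists2 j, (1 < j)%N & y \in gr j) -> negligible (x \ox y).
Proof.
move=> yP; exists [:: (x, y)]; last by rewrite big_seq1.
by move=> z; rewrite inE => /eqP->.
Qed.

Let negligible_mul t :
  negligible t -> negligible (braided_mul Y t (v \ox 1 + 1 \ox v)).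
Proof.
have mulD s x y :
      braided_mul Y s (x + y) = braided_mul Y s x + braided_mul Y s y.
  by have := braided_mul_linr s 1 x y; rewrite !scale1r.
move=> [s s_small ->].
pose F : {linear tensor R R -> tensor R R} :=
  HB.pack (fun s => braided_mul Y s (v \ox 1 + 1 \ox v))
   (GRing.isLinear.Build _ _ _ _ (fun s => braided_mul Y s (v \ox 1 + 1 \ox v))
     (braided_mul_linl _)).
rewrite -[braided_mul _ _ _]/(F _) linear_sum; apply: negligible_sum => z zs /=.
rewrite mulD braided_mul_one_right; apply: negligibleD.
  have [zw|[j j1 zj]] := s_small z zs.
    rewrite zw (braided_mul_pure _ _ _ (s := [:: (g, w)])) ?big_seq1 //.
    by apply: negligible_tens; left; rewrite mulr1.
  have [_ _ /(_ _ zj)[s' s'j z_co]] := gr_sub R_graded j.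
  rewrite (braided_mul_pure _ _ _ z_co); apply: negligible_sum => p ps'.
  by apply: negligible_tens; right; exists j; rewrite // mulr1 s'j.
apply: negligible_tens; right; have [->|[j j1 zj]] := s_small z zs.
  by exists 2%N => //; apply: (gr_mul R_graded (i := 1) (j := 1)).
by exists (j + 1)%N; [rewrite addn1 ltnS ltnW|apply: gr_mul].
Qed.

(** Multiplying by [v (x) 1 + 1 (x) v] on the right: [v^n (x) v] times
    [v (x) 1] is [v^n (1 . v) (x) v] plus a term with second factor [w], which
    adds one to the coefficient [n]; negligible terms stay negligible because
    the line of [w] and the homogeneous components are subcomodules. *)
Lemma power_coproduct n : exists2 t, negligible t &
  bDelta R (v ^+ n.+1) =
    v ^+ n.+1 \ox 1 + n.+1%:R *: (v ^+ n \ox v) + t.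
Proof.
have mulDl x y s :
    braided_mul Y (x + y) s = braided_mul Y x s + braided_mul Y y s.
  by have := braided_mul_linl s 1 x y; rewrite !scale1r.
have mulZl a x s : braided_mul Y (a *: x) s = a *: braided_mul Y x s.
  have mul0 : braided_mul Y 0 s = 0.
    by have := braided_mul_linl s (-1) 0 0; rewrite !scaleN1r oppr0 addr0 addNr.
  by have := braided_mul_linl s a x 0; rewrite mul0 !addr0.
have mulDr s x y :
    braided_mul Y s (x + y) = braided_mul Y s x + braided_mul Y s y.
  by have := braided_mul_linr s 1 x y; rewrite !scale1r.
have act1v : act Y 1 v = v by exact: (act1 (bh_is_yd R) v).
have co1 : coact Y 1 = 1 \ox 1.
  have [_ _ /(_ 1)] := bh_unit_mor R; rewrite /= scale1r => ->.
  rewrite tlift_bil ?scale1r //; apply: bilinear_forP => [x|x].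
    exact: tens_linl.
  apply: (linear_compose (@tens_linr _ _ _ _)) => a y z.
  by rewrite scalerDl -scalerA.
elim: n => [|n [t t0 IH]].
  by exists 0; rewrite // expr1 expr0 v_prim scale1r addr0.
rewrite exprSr bDeltaM IH v_prim !mulDl mulZl.
have -> : braided_mul Y (v ^+ n.+1 \ox 1) (v \ox 1 + 1 \ox v) =
    (v ^+ n.+1 * v) \ox 1 + v ^+ n.+1 \ox v.
  rewrite mulDr braided_mul_one_right mul1r.
  rewrite (braided_mul_pure _ _ _ (s := [:: (1, 1)])) ?big_seq1 //.
  by rewrite act1v mulr1.
have -> : braided_mul Y (v ^+ n \ox v) (v \ox 1 + 1 \ox v) =
    v ^+ n.+1 \ox v + ((v ^+ n * act Y h v) \ox w + v ^+ n \ox (v * v)).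
  rewrite mulDr braided_mul_one_right.
  rewrite (braided_mul_pure _ _ _ (s := [:: (1, v); (h, w)])); last first.
    by rewrite big_cons big_seq1.
  by rewrite big_cons big_seq1 /= act1v !mulr1 -exprSr addrA.
exists (n.+1%:R *: ((v ^+ n * act Y h v) \ox w + v ^+ n \ox (v * v))
        + braided_mul Y t (v \ox 1 + 1 \ox v)).
  apply: negligibleD; last exact: negligible_mul.
  rewrite scalerDr -!linearZl_LR; apply: negligibleD; apply: negligible_tens.
    by left.
  by right; exists 2%N => //; apply: (gr_mul R_graded (i := 1) (j := 1)).
rewrite scalerDr -[n.+2%:R]natr1 scalerDl scale1r !addrA; congr (_ + _ + _).
by rewrite addrAC.
Qed.

Hypotheses (char0 : [pchar k] =i pred0) (v_indep : forall x : k, v <> x *: w).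

Let graded_scale n x (y : R) : y \in gr n -> x *: y \in gr n.
Proof.
have [[g0 glin] _ _] := gr_sub R_graded n => yn.
by rewrite -[_ *: _]addr0 glin.
Qed.

Let graded0 n : 0 \in gr n.
Proof. by have [[g0 glin] _ _] := gr_sub R_graded n. Qed.

(** The sums of homogeneous elements whose component of degree 1 lies on the
    line of [w] form a subspace that does not contain [v]. *)
Lemma degree_one_functional : fin_dim R ->
  exists phi : {linear R -> k^o},
    [/\ phi 1 = 0, phi v = 1, phi w = 0 &
        forall j x, (1 < j)%N -> x \in gr j -> phi x = 0].
Proof.
move=> R_fin; pose homog n (F : nat -> R) :=
  (forall i, F i \in gr i) /\ (forall i, (n <= i)%N -> F i = 0).
(* Padding with zeros beyond n lets two such sums be added. *)
pose S := [pred x : R | `[< exists n F,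
  [/\ homog n F, exists y : k, F 1%N = y *: w & x = \sum_(i < n) F i] >]].
have S_sub : submod_closed S.
  split=> [|x y z]; rewrite !inE.
    apply/asboolP; exists 0%N, (fun=> 0); split; rewrite ?big_ord0 //.
    by exists 0; rewrite scale0r.
  move=> /asboolP[n [F [[Fgr F0] [Fw Fwe] ->]]].
  move=> /asboolP[m [G [[Ggr G0] [Gw Gwe] ->]]].
  apply/asboolP; exists (n + m)%N, (fun i => x *: F i + G i); split.
  - split=> i => [|nm_i].
      by have [[g0 glin] _ _] := gr_sub R_graded i; rewrite glin.
    by rewrite F0 ?G0 ?scaler0 ?addr0 //; apply: leq_trans nm_i;
      rewrite ?leq_addr ?leq_addl.
  - by exists (x * Fw + Gw); rewrite Fwe Gwe scalerDl scalerA.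
  rewrite big_split /= -scaler_sumr; congr (_ *: _ + _).
    rewrite big_split_ord /= [X in _ + X]big1 ?addr0 // => i _.
    by rewrite F0 ?leq_addr.
  rewrite addnC big_split_ord /= [X in _ + X]big1 ?addr0 // => i _.
  by rewrite G0 ?leq_addr.
have S_homog j x : x \in gr j -> (j = 1%N -> exists y : k, x = y *: w) ->
    x \in S.
  move=> xj j1; rewrite inE; apply/asboolP.
  exists j.+1, (fun i => if i == j then x else 0); split.
  - split=> i; first by case: eqP => [->|].
    by case: eqP => // ->; rewrite ltnn.
  - by case: eqP => [/esym/j1//|_]; exists 0; rewrite scale0r.
  rewrite big_ord_recr /= eqxx big1 ?add0r // => i _.
  by rewrite ltn_eqF.
have vS : v \notin S.
  rewrite inE; apply/asboolP => -[n [F [[Fgr F0] [y Fw] v_eq]]].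
  pose G i := (if i == 1%N then v else 0) - F i.
  have Ggr i : G i \in gr i.
    rewrite /G addrC -scaleN1r; have [[g0 glin] _ _] := gr_sub R_graded i.
    by rewrite glin //; case: eqP => [->|].
  have G_sum : \sum_(i < n.+2) G i = 0.
    rewrite sumrB; apply/eqP; rewrite subr_eq0; apply/eqP.
    rewrite 2!big_ord_recl /= add0r big1 ?addr0 //.
    rewrite [in LHS]v_eq -addn2 big_split_ord /=.
    by rewrite [X in _ + X]big1 ?addr0 // => i _; rewrite F0 ?leq_addr.
  have /eqP := gr_direct R_graded Ggr G_sum (isT : 1 < n.+2)%N.
  by rewrite /G /= subr_eq0 Fw => /eqP/v_indep.
have [phi [phi0 phi_v]] := separating_functional R_fin S_sub vS.
exists phi; split=> //.
- by apply/phi0/(S_homog 0%N) => //; apply: gr_one R_graded.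
- by apply/phi0/(S_homog 1%N) => // _; exists 1; rewrite scale1r.
by move=> j x j1 xj; apply/phi0/(S_homog j) => // j_eq; rewrite j_eq in j1.
Qed.

(** Contracting the second factor of [Delta (v^n)] with the functional of
    [degree_one_functional] yields [n v^(n-1)]: it acts as a derivation, and
    [v^n = 0] would force [v^(n-1) = 0] and finally [1 = 0]. *)
Lemma coinvariant_modulo_line_infinite : ~ fin_dim R.
Proof.
move=> R_fin.
have [phi [phi1 phi_v phi_w phi_high]] := degree_one_functional R_fin.
pose contract := fun x y : R => (phi y : k) *: x.
have contract_bil : bilinear_for *:%R *:%R contract.
  apply: bilinear_forP => [y|x] a u z; rewrite /contract.
    by rewrite scalerDr !scalerA mulrC.
  by rewrite linearP scalerDl scalerA.
have contractL := tlift_linear contract_bil.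
pose C : {linear tensor R R -> R} :=
  HB.pack (tlift contract) (GRing.isLinear.Build _ _ _ _ _ contractL).
have nat_neq0 n : n.+1%:R != 0 :> k.
  by move/pcharf0P: char0 => ->.
have v_pow n : v ^+ n != 0.
  elim: n => [|n IH]; first by rewrite expr0 oner_eq0.
  apply: contraNneq IH => vn0.
  have [t [s s_small ->]] := power_coproduct n.
  rewrite vn0 linear0 => /(congr1 C); rewrite linear0 !linearD linearZ /=.
  rewrite !tlift_bil // tlift_sum_tens // /contract phi1 phi_v scale0r add0r.
  rewrite big_seq big1 ?addr0 => [/esym/eqP|z zs].
    by rewrite scale1r scaler_eq0 (negPf (nat_neq0 n)).
  by have [->|[j j1 /phi_high->//]] := s_small z zs; rewrite ?phi_w scale0r.
have v_gr n : v ^+ n \in gr n.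
  elim: n => [|n IH]; first exact: gr_one R_graded.
  by rewrite exprSr -addn1 (gr_mul R_graded).
have [m m_bound] := free_sequence_bounded R_fin.
have [u [u0 u_rel]] := m_bound (GRing.exp v).
pose F i := if insub i is Some j then u 0 j *: v ^+ i else 0.
have F_gr i : F i \in gr i.
  rewrite /F; case: insubP => [j _ _|_]; first exact: graded_scale.
  exact: graded0.
have F_sum : \sum_(i < m) F i = 0.
  by rewrite -[RHS]u_rel; apply: eq_bigr => i _; rewrite /F valK.
have [j uj] := rV0Pn _ u0.
have := gr_direct R_graded F_gr F_sum (ltn_ord j).
by move/eqP; rewrite /F valK scaler_eq0 (negPf uj) (negPf (v_pow _)).
Qed.

End CoinvariantModuloLine.

(** Only the coaction of [M] is involved: degree one of the Nichols algebra is
    a copy of the comodule [M] and consists of primitive elements. *)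
Lemma nichols_infinite_of_coinvariant (k : fieldType)
    (char0 : [pchar k] =i pred0) (H : hopf_alg k) (M : yd_module H)
    (R : braided_hopf H) (gr : nat -> {pred R}) (R_nichols : is_nichols M gr)
    (g h : H) (v w : M) :
  coact (yd_str M) w = g \ox w -> coact (yd_str M) v = 1 \ox v + h \ox w ->
  (forall x : k, v <> x *: w) -> ~ fin_dim R.
Proof.
move=> w_co v_co v_indep.
have [iota [[iotaL _ iota_co] iota_inj iota_gr]] := nichols1 R_nichols.
have iota_bil : bilinear_for *:%R *:%R (fun (h0 : H) m => h0 \ox iota m).
  apply: bilinear_forP => [m|h0]; first exact: tens_linl.
  exact: (linear_compose (@tens_linr _ _ _ _)).
have iota_deg m : iota m \in gr 1%N by apply/iota_gr; exists m.
apply: (coinvariant_modulo_line_infinite (nichols_graded R_nichols)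
  (v := iota v) (w := iota w) (g := g) (h := h)) => //.
- exact/(nichols_prim R_nichols).
- by rewrite iota_co w_co tlift_bil.
- by rewrite iota_co v_co -[1 \ox v]scale1r (tlift_linear iota_bil) !tlift_bil
    ?scale1r.
move=> x; have iota0 : iota 0 = 0.
  by have := iotaL (-1) 0 0; rewrite scaler0 addr0 scaleN1r addNr.
have <- : iota (x *: w) = x *: iota w.
  by have := iotaL x w 0; rewrite iota0 !addr0.
by move/iota_inj/v_indep.
Qed.

(** * The Hopf algebra of dimension 8 *)
Section TensorSquareAlgebra.
Variables (k : fieldType) (A : algType k).

Let mul2_bil (x y : A) : bilinear_for *:%R *:%R
  (fun x' y' : A => (x * x') \ox (y * y')).
Proof.
by apply: bilinear_forP => [y'|x'];
  [apply: (linear_compose (@tens_linl _ _ _ _))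
  |apply: (linear_compose (@tens_linr _ _ _ _))] => r u v;
  rewrite mulrDr scalerAr.
Qed.

Let mul1_bil (t : tensor A A) : bilinear_for *:%R *:%R
  (fun x y : A => \sw_(x', y' <- t) (x * x') \ox (y * y')).
Proof.
apply: bilinear_forP => [y|x].
  apply: (@tlift_param _ _ _ _ _ (fun x x' y' => (x * x') \ox (y * y'))).
  move=> u v; apply: (linear_compose (@tens_linl _ _ _ _)) => r s s'.
  by rewrite mulrDl scalerAl.
apply: (@tlift_param _ _ _ _ _ (fun y x' y' => (x * x') \ox (y * y'))).
move=> u v; apply: (linear_compose (@tens_linr _ _ _ _)) => r s s'.
by rewrite mulrDl scalerAl.
Qed.

Lemma tens_mul_sums I J (r : seq I) (s : seq J) (x y : I -> A) (z w : J -> A) :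
  tens_mul (\sum_(i <- r) x i \ox y i) (\sum_(j <- s) z j \ox w j) =
  \sum_(i <- r) \sum_(j <- s) (x i * z j) \ox (y i * w j).
Proof.
rewrite /tens_mul tlift_sum_tens; last exact: mul1_bil.
by apply: eq_bigr => i _; rewrite tlift_sum_tens //; apply: mul2_bil.
Qed.

End TensorSquareAlgebra.

Lemma primitive_root4_sqr (k : fieldType) (xi : k) :
  4.-primitive_root xi -> xi ^+ 2 = -1.
Proof.
move=> xi_prim; have := prim_expr_order xi_prim.
rewrite (exprM xi 2 2) => /eqP; rewrite sqrf_eq1 => /orP[|/eqP//].
by rewrite -(prim_order_dvd xi_prim).
Qed.

Section CalK.
Variables (k : fieldType) (xi : k) (xi_sqr : xi ^+ 2 = -1).
Variables (K : hopf_alg k) (a b c d : K) (K_pres : is_calK xi a b c d).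

Definition monomial n m : K := a ^+ n * c ^+ m.

Lemma calK_d_monomial : d = monomial 3 0.
Proof.
rewrite /monomial expr0 mulr1 -[LHS]mul1r -(calK_a4 K_pres) exprSr -mulrA.
by rewrite (calK_ad K_pres) mulr1.
Qed.

Lemma calK_b_monomial : b = monomial 2 1.
Proof. by rewrite /monomial expr1 (calK_aac K_pres). Qed.

Lemma monomial_mul n m n' m' :
  monomial n m * monomial n' m' =
    (- xi) ^+ (m * n') *: monomial (n + n') (m + m').
Proof.
have ca : c * a = - xi *: (a * c).
  by rewrite (calK_ac K_pres) scalerA mulNr -expr2 xi_sqr opprK scale1r.
have can i : c * a ^+ i = (- xi) ^+ i *: (a ^+ i * c).
  elim: i => [|i IH]; first by rewrite !expr0 mulr1 mul1r scale1r.
  rewrite (exprSr a) mulrA IH -scalerAl -(mulrA _ c) ca -scalerAr scalerA.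
  by rewrite !exprSr !mulrA.
have cnm j i : c ^+ j * a ^+ i = (- xi) ^+ (j * i) *: (a ^+ i * c ^+ j).
  elim: j => [|j IH]; first by rewrite !expr0 mulr1 mul1r scale1r.
  rewrite (exprS c) -(mulrA c) IH -scalerAr (mulrA c) can -scalerAl scalerA.
  by rewrite -exprD mulSn addnC !mulrA.
rewrite /monomial -mulrA (mulrA (c ^+ m)) cnm -scalerAl -scalerAr.
by rewrite !exprD !mulrA.
Qed.

Lemma monomial_mod n m :
  monomial n m = if (m < 2)%N then monomial (n %% 4) m else 0.
Proof.
rewrite /monomial (expr_mod _ (calK_a4 K_pres)); case: ltnP => // m2.
by rewrite -(subnK m2) exprD (calK_cc K_pres) !mulr0.
Qed.

(** The exponents of [a] and of [c] in the basis
    [1, a^2, a c, a^3 c, a, a^2 c = b, c, a^3 = d].  With these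
    representatives every coefficient of [Delta] on the basis is 0 or 1. *)
Definition basis_exp_a : seq nat := [:: 0; 2; 1; 3; 1; 2; 0; 3]%N.
Definition basis_exp_c : seq nat := [:: 0; 0; 1; 1; 0; 1; 1; 0]%N.

Definition calK_basis i : K :=
  monomial (nth 0%N basis_exp_a i) (nth 0%N basis_exp_c i).
Notation e := calK_basis.

Definition basis_index n m := index (n %% 4, m)%N (zip basis_exp_a basis_exp_c).

Lemma basis_index_lt n m : (m < 2)%N -> (basis_index n m < 8)%N.
Proof.
rewrite /basis_index; have : (n %% 4 < 4)%N by rewrite ltn_mod.
by case: (n %% 4)%N => [|[|[|[|]]]] //; case: m => [|[|]].
Qed.

Lemma monomial_basis n m : (m < 2)%N -> monomial n m = e (basis_index n m).
Proof.
rewrite /basis_index.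
move=> m2; rewrite monomial_mod m2 /e; have : (n %% 4 < 4)%N by rewrite ltn_mod.
by case: (n %% 4)%N => [|[|[|[|]]]] //; case: m m2 => [|[|]].
Qed.

(** The elements that map the span of the monomials into itself by left
    multiplication form a subalgebra, which contains the generators. *)
Lemma calK_basis_span x : exists u : nat -> k,
  x = \sum_(i <- iota 0 8) u i *: e i.
Proof.
pose Sp := [pred y : K | `[< exists u : nat -> k,
  y = \sum_(i <- iota 0 8) u i *: e i >]].
have Sp_lin t y z : y \in Sp -> z \in Sp -> t *: y + z \in Sp.
  move=> /asboolP[u ->] /asboolP[v ->]; apply/asboolP.
  exists (fun i => t * u i + v i); rewrite scaler_sumr -big_split /=.
  by apply: eq_bigr => i _; rewrite scalerDl scalerA.
have Sp0 : 0 \in Sp.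
  by apply/asboolP; exists (fun=> 0); rewrite big1 // => i _; rewrite scale0r.
have SpZ t y : y \in Sp -> t *: y \in Sp.
  by move=> ySp; rewrite -[_ *: _]addr0 Sp_lin.
have Sp_monomial n m : monomial n m \in Sp.
  case: (ltnP m 2) => m2; last by rewrite monomial_mod ltnNge m2.
  rewrite monomial_basis //.
  have := basis_index_lt n m2; set l := basis_index _ _ => l8.
  apply/asboolP; exists (fun i => (i == l)%:R).
  rewrite (bigD1_seq l) ?mem_iota ?iota_uniq //= eqxx scale1r big1 ?addr0 //.
  by move=> i /negPf->; rewrite scale0r.
pose S := [pred y : K | `[< forall z, z \in Sp -> y * z \in Sp >]].
have S_monomial n m : monomial n m \in S.
  apply/asboolP => _ /asboolP[u ->]; rewrite mulr_sumr.
  apply: (big_ind (fun y => y \in Sp)) => // [y z ySp zSp|i _].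
    by rewrite -[y]scale1r Sp_lin.
  by rewrite -scalerAr monomial_mul !SpZ.
have S_alg : subalg_closed S.
  split=> [|t y z|y z].
  - by have := S_monomial 0%N 0%N; rewrite /monomial !expr0 mulr1.
  - move=> /asboolP yS /asboolP zS; apply/asboolP => x' x'S.
    by rewrite mulrDl -scalerAl Sp_lin ?yS ?zS.
  move=> /asboolP yS /asboolP zS; apply/asboolP => x' x'S.
  by rewrite -mulrA yS ?zS.
have /asboolP/(_ 1) : x \in S.
  apply: (calK_gen K_pres S_alg) => y [] ->.
  - by have := S_monomial 1%N 0%N; rewrite /monomial expr0 mulr1.
  - by rewrite calK_b_monomial.
  - by have := S_monomial 0%N 1%N; rewrite /monomial expr0 mul1r.
  by rewrite calK_d_monomial.
rewrite mulr1 => x_Sp; apply/asboolP/x_Sp.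
by have := Sp_monomial 0%N 0%N; rewrite /monomial !expr0 mulr1.
Qed.

(** The pair [(i, j)] stands for the tensor of the basis elements [i] and [j].
    Indices 0 to 3 span a pointed subcoalgebra, 4 to 7 a matrix coalgebra. *)
Definition calK_coproduct (l : nat) : seq (nat * nat) :=
  nth [::] [:: [:: (0, 0)]; [:: (1, 1)]; [:: (2, 1); (0, 2)];
    [:: (3, 0); (1, 3)]; [:: (4, 4); (5, 6)]; [:: (4, 5); (5, 7)];
    [:: (6, 4); (7, 6)]; [:: (6, 5); (7, 7)]]%N l.

Lemma basis0 : e 0%N = 1. Proof. by rewrite /e /monomial /= mul1r. Qed.
Lemma basis4 : e 4%N = a. Proof. by rewrite /e /monomial /= mulr1. Qed.
Lemma basis5 : e 5%N = b. Proof. by rewrite calK_b_monomial. Qed.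
Lemma basis6 : e 6%N = c. Proof. by rewrite /e /monomial /= mul1r. Qed.
Lemma basis7 : e 7%N = d. Proof. by rewrite calK_d_monomial. Qed.

Lemma basis_mul i j :
  e i * e j =
    let ma := nth 0%N basis_exp_a in let mc := nth 0%N basis_exp_c in
    if (mc i + mc j < 2)%N
    then (- xi) ^+ (mc i * ma j) *:
      e (basis_index (ma i + ma j) (mc i + mc j))
    else 0.
Proof.
rewrite /= /e monomial_mul; case: ifP => [m2|m2].
  by rewrite monomial_basis.
by rewrite monomial_mod m2 scaler0.
Qed.

Lemma Delta_basis l : (l < 8)%N ->
  hDelta K (e l) = \sum_(z <- calK_coproduct l) e z.1 \ox e z.2.
Proof.
have Da : hDelta K (e 4%N) = \sum_(z <- calK_coproduct 4) e z.1 \ox e z.2.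
  rewrite !big_cons big_nil addr0 basis4 basis5 basis6.
  exact: calK_Delta_a K_pres.
have Dc : hDelta K (e 6%N) = \sum_(z <- calK_coproduct 6) e z.1 \ox e z.2.
  rewrite !big_cons big_nil addr0 basis4 basis7 basis6.
  exact: calK_Delta_c K_pres.
have Dg : hDelta K (e 1%N) = \sum_(z <- calK_coproduct 1) e z.1 \ox e z.2.
  have -> : e 1%N = e 4%N * e 4%N by rewrite basis_mul /basis_index /= scale1r.
  rewrite hDeltaM Da tens_mul_sums !(big_cons, big_nil) !addr0 !basis_mul
    /basis_index /=.
  rewrite !scale1r !linear0l addr0 !linearZl_LR !linearZr_LR /= !expr1.
  rewrite scalerA mulrNN -expr2 xi_sqr scaleN1r.
  by rewrite addrK.
have Dx : hDelta K (e 2%N) = \sum_(z <- calK_coproduct 2) e z.1 \ox e z.2.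
  have -> : e 2%N = e 4%N * e 6%N by rewrite basis_mul /basis_index /= scale1r.
  rewrite hDeltaM Da Dc tens_mul_sums !(big_cons, big_nil) !addr0 !basis_mul
    /basis_index /=.
  by rewrite !scale1r !linear0l ?linear0r !addr0.
have Dy : hDelta K (e 3%N) = \sum_(z <- calK_coproduct 3) e z.1 \ox e z.2.
  have -> : e 3%N = e 1%N * e 2%N by rewrite basis_mul /basis_index /= scale1r.
  rewrite hDeltaM Dg Dx tens_mul_sums !(big_cons, big_nil) !addr0 !basis_mul
    /basis_index /=.
  by rewrite !scale1r.
case: l => [|[|[|[|[|[|[|[|]]]]]]]] // _.
- by rewrite big_seq1 basis0 hDelta1.
- rewrite !big_cons big_nil addr0 basis4 basis5 basis7.
  exact: calK_Delta_b K_pres.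
rewrite !big_cons big_nil addr0 basis7 basis5 basis6.
exact: calK_Delta_d K_pres.
Qed.

End CalK.

(** * Comodules as families of operators *)
Section CoactionOperators.
Variables (k : fieldType) (xi : k) (xi_sqr : xi ^+ 2 = -1).
Variables (K : hopf_alg k) (a b c d : K) (K_pres : is_calK xi a b c d).
Notation e := (calK_basis a c).
Variable eps : nat -> {linear K -> k^o}.
Hypothesis eps_e :
  forall i j, (i < 8)%N -> (j < 8)%N -> eps i (e j) = (i == j)%:R.
Hypothesis eps_span : forall x, x = \sum_(i <- iota 0 8) (eps i x : k) *: e i.
Variables (M : lmodType k) (Y : yd_data K M) (M_yd : is_yd Y).

(** The action on [M] of the functional [eps i] of the dual algebra. *)
Definition coef (i : nat) (m : M) : M :=
  \sw_(h, m0 <- coact Y m) (eps i h : k) *: m0.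

Lemma coef_is_linear i : linear (coef i).
Proof.
move=> x u v; rewrite /coef (coact_linear M_yd).
by rewrite (tlift_linear (scale_bilinear (eps i))).
Qed.

Lemma coef_zero i : coef i 0 = 0.
Proof.
by have := coef_is_linear i (-1) 0 0; rewrite scaler0 addr0 scaleN1r addNr.
Qed.

Lemma coact_coef m : coact Y m = \sum_(i <- iota 0 8) e i \ox coef i m.
Proof.
rewrite [LHS]tens_span; set s := repr _.
under [RHS]eq_bigr do rewrite /coef [coact Y m]tens_span
  (tlift_sum_tens _ _ _ (scale_bilinear _)) -/s linear_sumr.
rewrite exchange_big; apply: eq_bigr => p _ /=.
rewrite [in LHS](eps_span p.1) linear_sumlz; apply: eq_bigr => i _ /=.
by rewrite linearZl_LR linearZr_LR.
Qed.

Lemma coef_basis_sum i (F : nat -> M) : (i < 8)%N ->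
  \sw_(h, m0 <- \sum_(j <- iota 0 8) e j \ox F j) (eps i h : k) *: m0 = F i.
Proof.
move=> i8; rewrite tlift_sum_tens; last exact: scale_bilinear.
rewrite (bigD1_seq i) ?mem_iota ?iota_uniq // eps_e // eqxx scale1r.
rewrite big_seq_cond big1 => [|j]; first exact: addr0.
rewrite mem_iota => /andP[j8 /negPf ji].
by rewrite eps_e // eq_sym ji scale0r.
Qed.

Lemma coact_sum_coef (W : lmodType k) (f : K -> M -> W) m :
    bilinear_for *:%R *:%R f ->
  tlift f (coact Y m) = \sum_(i <- iota 0 8) f (e i) (coef i m).
Proof. by move=> f_bil; rewrite coact_coef tlift_sum_tens. Qed.

Let assoc_bil : bilinear_for *:%R *:%R
  (fun h (m : M) => \sw_(h1, h2 <- hDelta K h) h1 \ox (h2 \ox m)).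
Proof.
have assoc1 (m : M) :
      bilinear_for *:%R *:%R (fun h1 h2 : K => h1 \ox (h2 \ox m)).
  apply: bilinear_forP => [v|u]; first exact: tens_linl.
  by apply: (linear_compose (@tens_linr _ _ _ _)); apply: tens_linl.
apply: bilinear_forP => [m|h].
  by apply: (linear_compose (f := hDelta K) (tlift_linear (assoc1 m)));
    apply: linearP.
apply: (@tlift_param _ _ _ _ _ (fun m h1 h2 => h1 \ox (h2 \ox m))) => u v.
by apply: (linear_compose (@tens_linr _ _ _ _)); apply: tens_linr.
Qed.

Let coassoc_bil : bilinear_for *:%R *:%R 
  (fun (h : K) (m : M) => h \ox coact Y m).
Proof.
apply: bilinear_forP => [m|h]; first exact: tens_linl.
by apply: (linear_compose (@tens_linr _ _ _ _)); apply: coact_linear M_yd.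
Qed.

(** Coassociativity, read off coefficient by coefficient.  Each pair [(i, j)]
    occurs in the coproduct of at most one basis element, so the operators
    multiply like the arrows of a quiver. *)
Lemma coef_coef i j m : (i < 8)%N -> (j < 8)%N ->
  coef j (coef i m) =
  if ohead [seq l <- iota 0 8 | (i, j) \in calK_coproduct l] is Some l
  then coef l m else 0.
Proof.
move=> i8 j8.
pose contract2 (h : K) (t : tensor K M) : M :=
  (eps i h : k) *: (\sw_(h', m0 <- t) (eps j h' : k) *: m0).
have contract2_bil : bilinear_for *:%R *:%R contract2.
  apply: bilinear_forP => [v|u] x y z; rewrite /contract2.
    by rewrite linearP scalerDl -scalerA.
  rewrite (tlift_linear (scale_bilinear (eps j)) x y z).
  by rewrite scalerDr !scalerA mulrC.
have := coact_coassoc M_yd m.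
rewrite (coact_sum_coef _ assoc_bil) (coact_sum_coef _ coassoc_bil).
move=> /(congr1 (tlift contract2)); rewrite tlift_sum_tens //.
have -> : \sum_(l <- iota 0 8) contract2 (e l) (coact Y (coef l m)) =
    coef j (coef i m).
  rewrite (bigD1_seq i) ?mem_iota ?iota_uniq //.
  rewrite {1}/contract2 eps_e // eqxx scale1r big_seq_cond big1 => [|l].
    exact: addr0.
  rewrite mem_iota => /andP[l8 /negPf li].
  by rewrite /contract2 eps_e // eq_sym li scale0r.
move=> <-; rewrite tlift_lin_sum //.
have term l : (l < 8)%N ->
    tlift contract2 (\sw_(h1, h2 <- hDelta K (e l)) h1 \ox (h2 \ox coef l m)) =
    if (i, j) \in calK_coproduct l then coef l m else 0.
  move=> l8; rewrite (Delta_basis xi_sqr K_pres) // tlift_sum_tens; last first.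
    apply: bilinear_forP => [v|u]; first exact: tens_linl.
    by apply: (linear_compose (@tens_linr _ _ _ _)); apply: tens_linl.
  rewrite tlift_sum_tens //.
  have /andP[cop8 cop_uniq] : all (fun z => (z.1 < 8) && (z.2 < 8))%N
      (calK_coproduct l) && uniq (calK_coproduct l).
    by do 8![case: l l8 => [|l] l8 //].
  have contractE z : z \in calK_coproduct l ->
      contract2 (e z.1) (e z.2 \ox coef l m) =
      if z == (i, j) then coef l m else 0.
    case: z => z1 z2 /(allP cop8)/andP[/= z18 z28]; rewrite xpair_eqE.
    rewrite /contract2 tlift_bil ?eps_e //; last exact: scale_bilinear.
    rewrite scalerA -natrM mulnb [z1 == i]eq_sym [z2 == j]eq_sym.
    by case: ifP => _; rewrite ?scale1r ?scale0r.
  rewrite big_seq (eq_bigr _ contractE) -big_seq -big_mkcond /=.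
  case: ifP => ij_l; last first.
    by rewrite big_seq_cond big1 // => z /andP[zl /eqP zE];
      rewrite -zE zl in ij_l.
  by rewrite -big_filter filter_pred1_uniq // big_seq1.
rewrite big_seq (eq_bigr (fun l => if (i, j) \in calK_coproduct l
    then coef l m else 0)); last first.
  by move=> l; rewrite mem_iota => l8; rewrite term.
rewrite -big_seq -big_mkcond -big_filter.
have one_source : all (fun z => size [seq l <- iota 0 8 |
    z \in calK_coproduct l] <= 1)%N [seq (i, j) | i <- iota 0 8, j <- iota 0 8].
  by [].
have /(allP one_source) :
    (i, j) \in [seq (i, j) | i <- iota 0 8, j <- iota 0 8].
  by apply/allpairsP; exists (i, j); rewrite !mem_iota.
by case: [seq l <- _ | _] => [|l [|//]] _; rewrite ?big_nil ?big_seq1.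
Qed.

Lemma coef_sum_one m : coef 0 m + coef 1 m + coef 4 m + coef 7 m = m.
Proof.
have := coact_counit M_yd m.
rewrite (coact_sum_coef _ (scale_bilinear _)) !big_cons big_nil.
have eps_monomial n n' : heps K (monomial a c n n') = (n' == 0%N)%:R.
  have heps_exp x i : heps K (x ^+ i) = (heps K x : k) ^+ i.
    elim: i => [|i IH]; first by rewrite !expr0 heps1.
    by rewrite !exprS hepsM IH.
  rewrite /monomial hepsM !heps_exp (calK_eps_a K_pres) (calK_eps_c K_pres).
  by rewrite expr1n mul1r expr0n.
by rewrite !eps_monomial /= !scale1r !scale0r !add0r addr0 !addrA.
Qed.

Notation action := (act Y).

Let act_linl m : linear (fun h => action h m) := (act_bilinear M_yd).1 m.
Let act_linr h : linear (action h) := (act_bilinear M_yd).2 h.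

(** Expanding the iterated coproduct of [e l] and the coaction of [m] over the
    basis turns the Yetter-Drinfeld condition into a finite table: all products
    in [K] that occur are again scalar multiples of basis elements. *)
Lemma coef_act j l m : (j < 8)%N -> (l < 8)%N ->
  coef j (action (e l) m) =
  \sum_(z <- calK_coproduct l) \sum_(z' <- calK_coproduct z.2)
    \sum_(n <- iota 0 8) (eps j (e z.1 * e n * hS K (e z'.2)) : k) *:
       action (e z'.1) (coef n m).
Proof.
move=> j8 l8.
have cop8 i : (i < 8)%N -> {in calK_coproduct i, forall z, z.2 < 8}%N.
  by move=> i8; apply/allP; do 8![case: i i8 => [|i] i8 //].
have bil1 h1 h2 h3 : bilinear_for *:%R *:%R
    (fun m1 m0 => (h1 * m1 * hS K h3) \ox action h2 m0).
  apply: bilinear_forP => [v|u].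
    apply: (linear_compose (@tens_linl _ _ _ _)) => x y z.
    by rewrite mulrDr mulrDl -scalerAr -scalerAl.
  by apply: (linear_compose (@tens_linr _ _ _ _)).
have bil2 h1 : bilinear_for *:%R *:%R (fun h2 h3 =>
    \sw_(m1, m0 <- coact Y m) (h1 * m1 * hS K h3) \ox action h2 m0).
  apply: bilinear_forP => [h3|h2].
    apply: (@tlift_param _ _ _ _ _
      (fun h2 m1 m0 => (h1 * m1 * hS K h3) \ox action h2 m0)) => u v.
    by apply: (linear_compose (@tens_linr _ _ _ _)).
  apply: (@tlift_param _ _ _ _ _
    (fun h3 m1 m0 => (h1 * m1 * hS K h3) \ox action h2 m0)) => u v.
  apply: (linear_compose (@tens_linl _ _ _ _)) => x y z.
  by rewrite linearP mulrDr scalerAr.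
have bil3 : bilinear_for *:%R *:%R (fun h1 h23 =>
    \sw_(h2, h3 <- hDelta K h23) \sw_(m1, m0 <- coact Y m)
      (h1 * m1 * hS K h3) \ox action h2 m0).
  apply: bilinear_forP => [h23|h1].
    apply: (@tlift_param _ _ _ _ _ (fun h1 h2 h3 =>
      \sw_(m1, m0 <- coact Y m) (h1 * m1 * hS K h3) \ox action h2 m0)) => u v.
    apply: (@tlift_param _ _ _ _ _
      (fun h1 m1 m0 => (h1 * m1 * hS K v) \ox action u m0)) => u' v'.
    apply: (linear_compose (@tens_linl _ _ _ _)) => x y z.
    by rewrite !mulrDl !scalerAl.
  by move=> x y z; rewrite linearP (tlift_linear (bil2 h1)).
rewrite /coef (yd_compat M_yd) (Delta_basis xi_sqr K_pres l8) tlift_sum_tens //.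
rewrite (tlift_lin_sum _ _ (scale_bilinear _)) !big_seq.
apply: eq_bigr => z /(cop8 _ l8) z8.
rewrite (Delta_basis xi_sqr K_pres z8) tlift_sum_tens //.
rewrite (tlift_lin_sum _ _ (scale_bilinear _)); apply: eq_bigr => z' _.
rewrite (coact_sum_coef _ (bil1 _ _ _)).
by rewrite (tlift_sum_tens _ _ _ (scale_bilinear _)).
Qed.

Lemma eps_mul3 j i n l : (j < 8)%N ->
  eps j (e i * e n * e l) =
    let ma := nth 0%N basis_exp_a in let mc := nth 0%N basis_exp_c in
    if (mc i + mc n + mc l < 2)%N &&
       (j == basis_index (ma i + ma n + ma l) (mc i + mc n + mc l))
    then (- xi) ^+ (mc i * ma n + (mc i + mc n) * ma l) else 0 :> k.
Proof.
move=> j8; rewrite /= !(monomial_mul xi_sqr K_pres) -scalerAl.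
rewrite !(monomial_mul xi_sqr K_pres).
case: ltnP => [c2|c2]; last first.
  by rewrite (monomial_mod K_pres) ltnNge c2 /= !scaler0 linear0.
rewrite scalerA -exprD (monomial_basis K_pres) // linearZ /= eps_e //.
  by case: eqP => _; [apply: mulr1|apply: mulr0].
exact: basis_index_lt.
Qed.

Lemma action_monomial n n' m :
  action (monomial a c n n') m = iter n (action a) (iter n' (action c) m).
Proof.
have action_exp x i m' : action (x ^+ i) m' = iter i (action x) m'.
  elim: i => [|i IH]; first by rewrite expr0 (act1 M_yd).
  by rewrite exprS (actM M_yd) IH.
by rewrite /monomial (actM M_yd) !action_exp.
Qed.

Lemma action_square_c m : action c (action c m) = 0.
Proof.
rewrite -(actM M_yd) -expr2 (calK_cc K_pres).
by have := act_linl m (-1) 0 0; rewrite scaler0 addr0 scaleN1r addNr.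
Qed.

Lemma action_order_a m : action a (action a (action a (action a m))) = m.
Proof.
by have := action_monomial 4 0 m;
  rewrite (monomial_mod K_pres) /monomial mulr1 (act1 M_yd). Qed.

Lemma action_a_c m : action a (action c m) = xi *: action c (action a m).
Proof.
rewrite -!(actM M_yd) (calK_ac K_pres).
have := act_linl m xi (c * a) 0; rewrite !addr0 => ->.
have := act_linl m (-1) 0 0; rewrite scaler0 addr0 scaleN1r addNr => ->.
by rewrite addr0.
Qed.

(** * Commutation relations in the absence of the trivial comodule *)
Section NoTrivialFactor.
Hypothesis coef0 : forall m, coef 0 m = 0.

(** The arrow of index 2 starts at the image of [coef 0] and that of index 3
    ends there. *)
Lemma coef2 m : coef 2 m = 0.
Proof. by have := @coef_coef 0 2 m isT isT; rewrite coef0 coef_zero. Qed.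

Lemma coef3 m : coef 3 m = 0.
Proof. by have := @coef_coef 3 0 m isT isT; rewrite coef0. Qed.

Lemma antipode_e4 : hS K (e 4%N) = e 7%N.
Proof. by rewrite basis4 (calK_S_a K_pres) (basis7 K_pres). Qed.

Lemma antipode_e6 : hS K (e 6%N) = - xi *: e 6%N.
Proof. by rewrite basis6 (calK_S_c K_pres). Qed.

(** Evaluates a coefficient of the coaction of [a m] or [c m] by the
    Yetter-Drinfeld condition and the multiplication table of the basis. *)
Ltac expand_coef :=
  rewrite coef_act // !(big_cons, big_nil) /= ?antipode_e4 ?antipode_e6;
  rewrite -?(scalerAr (- xi)) ?(linearZ, linear0) !eps_mul3 // /basis_index /=;
  rewrite ?(coef0, coef2, coef3, linear0, scaler0, scale0r, add0r, addr0);
  rewrite /calK_basis !action_monomial /=.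

Let xi3 : (- xi) ^+ 3 = xi.
Proof. by ring: xi_sqr. Qed.

Let xi6 : (- xi) ^+ (3 + 3) = -1.
Proof. by rewrite exprD xi3 -expr2. Qed.

Let xi4 : (- xi) ^+ (1 + 3) = 1.
Proof. by rewrite exprD expr1 xi3 mulNr -expr2 xi_sqr opprK. Qed.

Ltac close_coef := rewrite ?(mul0n, muln0, mul1n, muln1, addn0, add0n)
  ?(xi3, xi4, xi6, expr0, mulr1, scale1r, scaleN1r, scaler0) ?addrA ?scaleNr
  ?regular_scale ?mulr1 ?scalerN.

Lemma coef1_a m : coef 1 (action a m) = action a (coef 1 m).
Proof. by rewrite -{1}[a](basis4 a c); expand_coef; close_coef. Qed.

Lemma coef4_a m : coef 4 (action a m) = action a (coef 4 m).
Proof. by rewrite -{1}[a](basis4 a c); expand_coef; close_coef. Qed.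

Lemma coef6_a m : coef 6 (action a m) = xi *: action a (coef 6 m)
  - xi *: action a (action a (action c (coef 7 m))) - action c (coef 7 m).
Proof.
by rewrite -{1}[a](basis4 a c); expand_coef; close_coef.
Qed.

Lemma coef1_c m : coef 1 (action c m) = 0.
Proof.
rewrite -[c](basis6 a c); expand_coef.
by have := act_linr c (-1) 0 0; rewrite scaler0 addr0 scaleN1r addNr => ->;
  rewrite scaler0.
Qed.

(** The Yetter-Drinfeld condition identifies [c (coef 1 m)] with
    [coef 0 (c m)], which is zero. *)
Lemma action_c_coef1 m : action c (coef 1 m) = 0.
Proof.
have := coef0 (action c m); rewrite -{1}[c](basis6 a c).
by expand_coef; close_coef.
Qed.

Lemma coef4_c m : coef 4 (action c m) = action c (coef 7 m).
Proof. by rewrite -{1}[c](basis6 a c); expand_coef; close_coef. Qed.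

Lemma coef7_c m : coef 7 (action c m) = action c (coef 4 m).
Proof. by rewrite -{1}[c](basis6 a c); expand_coef; close_coef. Qed.

Lemma coef5_c m : coef 5 (action c m) = - action a (coef 7 m)
  + xi *: action c (coef 6 m) - xi *: action a (action a (action a (coef 7 m))).
Proof. by rewrite -{1}[c](basis6 a c); expand_coef; close_coef. Qed.

Lemma coef6_c m : coef 6 (action c m) = action a (coef 4 m)
  + xi *: action c (coef 5 m) - xi *: action a (action a (action a (coef 4 m))).
Proof. by rewrite -{1}[c](basis6 a c); expand_coef; close_coef. Qed.

End NoTrivialFactor.
End CoactionOperators.

(** * Averaging a projection *)
Section InvariantProjection.
Variables (k : fieldType) (xi : k).
Hypotheses (xi_sqr : xi ^+ 2 = -1) (two_neq0 : 2%:R != 0 :> k).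
Variables (M : lmodType k) (M_fin : fin_dim M).
Variables (T : nat -> {linear M -> M}) (alpha gamma : {linear M -> M}).
Notation q := (T 1). Notation A := (T 4). Notation B := (T 5).
Notation C := (T 6). Notation D := (T 7).

Hypothesis T_T : forall i j m, (i < 8)%N -> (j < 8)%N ->
  T j (T i m) =
  if ohead [seq l <- iota 0 8 | (i, j) \in calK_coproduct l] is Some l
  then T l m else 0.
Hypothesis T_one : forall m, q m + A m + D m = m.
Hypothesis alpha4 : forall m, alpha (alpha (alpha (alpha m))) = m.
Hypothesis gamma2 : forall m, gamma (gamma m) = 0.
Hypothesis alpha_gamma : forall m, alpha (gamma m) = xi *: gamma (alpha m).
Hypothesis q_alpha : forall m, q (alpha m) = alpha (q m).
Hypothesis A_alpha : forall m, A (alpha m) = alpha (A m).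
Hypothesis C_alpha : forall m, C (alpha m) =
  xi *: alpha (C m) - xi *: alpha (alpha (gamma (D m))) - gamma (D m).
Hypothesis q_gamma : forall m, q (gamma m) = 0.
Hypothesis gamma_q : forall m, gamma (q m) = 0.
Hypothesis A_gamma : forall m, A (gamma m) = gamma (D m).
Hypothesis D_gamma : forall m, D (gamma m) = gamma (A m).
Hypothesis B_gamma : forall m, B (gamma m) =
  - alpha (D m) + xi *: gamma (C m) - xi *: alpha (alpha (alpha (D m))).
Hypothesis C_gamma : forall m, C (gamma m) =
  alpha (A m) + xi *: gamma (B m) - xi *: alpha (alpha (alpha (A m))).

Variables (U : {pred M}) (U_sub : submod_closed U).
Hypothesis U_T : forall i m, (i < 8)%N -> m \in U -> T i m \in U.
Hypothesis U_alpha : forall m, m \in U -> alpha m \in U.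
Hypothesis U_gamma : forall m, m \in U -> gamma m \in U.

Ltac push_linear :=
  rewrite ?(scalerA, scalerDr, scalerN, linearD, linearN, linearZ, linear0) /=.

Ltac by_coordinates :=
  apply: (vector_eq_by_coordinates M_fin) => ?; push_linear;
  rewrite ?regular_scale.

(** On the image of [A], the operators [alpha] and [Y] generate a commutative
    algebra, and [e] is the idempotent with the same kernel as [Y]. *)
Section Averaging.
Variable Y : {linear M -> M}.
Hypothesis YE : forall m, Y m = C (gamma m).

Let gamma_alpha m : gamma (alpha m) = - xi *: alpha (gamma m).
Proof. by rewrite alpha_gamma scalerA mulNr -expr2 xi_sqr opprK scale1r. Qed.

Let Y_alpha m : Y (alpha m) = alpha (Y m).
Proof.
rewrite !YE gamma_alpha linearZ /= C_alpha D_gamma gamma2 !linear0.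
by by_coordinates; ring: xi_sqr.
Qed.

Let Y_A m : Y (A m) = Y m.
Proof. by rewrite !YE -D_gamma T_T. Qed.

Let A_Y m : A (Y m) = Y m.
Proof. by rewrite YE T_T. Qed.

(** This is the relation for [B gamma] at [gamma m], where [gamma (gamma m)]
    vanishes. *)
Let gamma_Y m :
  gamma (Y m) =
    - xi *: alpha (gamma (A m)) + alpha (alpha (alpha (gamma (A m)))).
Proof.
have := B_gamma (gamma m); rewrite gamma2 linear0 D_gamma -YE => rel.
rewrite -[LHS]addr0 -[0](scaler0 _ xi) rel.
by by_coordinates; ring: xi_sqr.
Qed.

Let Y_Y m : Y (Y m) = alpha (Y m) - xi *: alpha (alpha (alpha (Y m))).
Proof.
rewrite [LHS]YE gamma_Y !alpha_gamma !linearZ /= !alpha_gamma !linearZ /=.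
rewrite !alpha_gamma !linearD !linearZ /= -!YE !Y_alpha Y_A.
by by_coordinates; ring: xi_sqr.
Qed.

Variable e : {linear M -> M}.
Hypothesis eE : forall m,
  e m = 2%:R^-1 *: (alpha (alpha (alpha (Y m))) + xi *: alpha (Y m)).

Let e_alpha m : e (alpha m) = alpha (e m).
Proof. by rewrite !eE !Y_alpha; by_coordinates; ring. Qed.

(** The factor [(a^3 + xi a) / 2] inverts [a - xi a^3], and [Y_Y] says that
    [Y^2 = (a - xi a^3) Y]. *)
Let Y_e m : Y (e m) = Y m.
Proof.
rewrite eE; push_linear; rewrite !Y_alpha Y_Y; push_linear.
rewrite !alpha4.
by by_coordinates; field: xi_sqr.
Qed.

Let e_e m : e (e m) = e m.
Proof. by rewrite eE Y_e. Qed.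

Let Y_from_e m : Y m = alpha (e m) - xi *: alpha (alpha (alpha (e m))).
Proof.
rewrite eE; push_linear; rewrite !alpha4.
by by_coordinates; field: xi_sqr.
Qed.

(** A map [x |-> sum_i s_i pi t_i] still has values in [U] and fixes [U]
    whenever the [s_i] and [t_i] preserve [U] and [sum_i s_i t_i = 1].  The
    families used in turn are the powers of [alpha] (divided by 4), the pair
    [e, 1 - e], and finally [q, A, B] on the left with [q, A, C] on the right.
    After the second step the map commutes with [alpha] and [e], hence with
    [Y]; the relations express [alpha] and [gamma] through [alpha], [Y] and the
    matrix units, so the last step yields a map that commutes with them. *)
Lemma averaged_projection : exists P : {linear M -> M},
  [/\ forall m, P m \in U, forall u, u \in U -> P u = u,
      forall m, P (alpha m) = alpha (P m), forall m, P (gamma m) = gamma (P m) &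
      forall i m, i \in [:: 1; 4; 5; 6; 7]%N -> P (T i m) = T i (P m)].
Proof.
have [pi [pi_U pi_id]] := linear_projection M_fin U_sub.
have UD m n : m \in U -> n \in U -> m + n \in U.
  by case: U_sub => _ Ul mU nU; rewrite -[m]scale1r Ul.
have UZ x m : m \in U -> x *: m \in U.
  by case: U_sub => U0 Ul mU; rewrite -[_ *: _]addr0 Ul.
have UB m n : m \in U -> n \in U -> m - n \in U.
  by move=> mU nU; rewrite UD // -scaleN1r UZ.
have U_e m : m \in U -> e m \in U.
  move=> mU; have YU : Y m \in U by rewrite YE U_T // U_gamma.
  by rewrite eE UZ // UD ?UZ ?U_alpha.
have [p1 p1E] : exists p1 : {linear M -> M}, forall m,
    p1 m = 4%:R^-1 *: (pi m + alpha (pi (alpha (alpha (alpha m))))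
      + alpha (alpha (pi (alpha (alpha m))))
      + alpha (alpha (alpha (pi (alpha m))))).
  by exists (4%:R^-1 \*: (pi \+ (alpha \o pi \o alpha \o alpha \o alpha)
    \+ (alpha \o alpha \o pi \o alpha \o alpha)
    \+ (alpha \o alpha \o alpha \o pi \o alpha))).
have four_neq0 : 4%:R != 0 :> k by rewrite (natrM _ 2 2) mulf_neq0.
have p1_alpha m : p1 (alpha m) = alpha (p1 m).
  rewrite !p1E !alpha4; push_linear; rewrite alpha4.
  by by_coordinates; ring.
have p1_U m : p1 m \in U by rewrite p1E UZ // !UD ?U_alpha.
have p1_id u : u \in U -> p1 u = u.
  move=> uU; rewrite p1E !pi_id ?U_alpha // !alpha4.
  by by_coordinates; field.
have [p2 p2E] : exists p2 : {linear M -> M}, forall m,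
    p2 m = e (p1 (e m)) + (p1 (m - e m) - e (p1 (m - e m))).
  by exists ((e \o p1 \o e) \+ ((p1 \- (e \o p1)) \o (idfun \- e))).
have p2_alpha m : p2 (alpha m) = alpha (p2 m).
  by rewrite !p2E e_alpha -linearB !p1_alpha !e_alpha -linearB -linearD.
have p2_e m : p2 (e m) = e (p2 m).
  rewrite !p2E e_e subrr; push_linear; rewrite !e_e.
  by by_coordinates; ring.
have p2_U m : p2 m \in U by rewrite p2E UD ?UB ?U_e.
have p2_id u : u \in U -> p2 u = u.
  move=> uU; have eu := U_e _ uU.
  rewrite p2E (p1_id (e u)) // (p1_id (u - e u)) ?UB //; push_linear.
  rewrite e_e.
  by by_coordinates; ring.
have p2_Y m : p2 (Y m) = Y (p2 m).
  by rewrite !Y_from_e linearB linearZ /= !p2_alpha p2_e.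
have [rho rhoE] : exists rho : {linear M -> M}, forall m,
    rho m = A (p2 (A m)).
  by exists (A \o p2 \o A).
have rho_alpha m : rho (alpha m) = alpha (rho m).
  by rewrite !rhoE A_alpha p2_alpha A_alpha.
have rho_Y m : rho (Y m) = Y (rho m).
  by rewrite !rhoE A_Y Y_A -p2_Y Y_A p2_Y A_Y.
(* On the image of D, which B and C identify with the image of A, both gamma
   and alpha are expressed by operators phi and theta built from alpha and Y. *)
have [phi phiE] : exists phi : {linear M -> M}, forall m,
    phi m = - xi *: Y m + xi *: alpha m + alpha (alpha (alpha m)).
  by exists ((- xi \*: Y) \+ (xi \*: alpha) \+ (alpha \o alpha \o alpha)).
have gamma_B m : gamma (B m) = phi (A m).
  rewrite phiE Y_A YE C_gamma.
  by by_coordinates; ring: xi_sqr.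
have [theta thetaE] : exists theta : {linear M -> M}, forall m,
    theta m = xi *: alpha m - xi *: alpha (alpha (phi m)) - phi m.
  by exists ((xi \*: alpha) \- (xi \*: (alpha \o alpha \o phi)) \- phi).
have C_alpha_theta m : C (alpha m) = theta (C m).
  have D_BC : D m = B (C m) by rewrite T_T.
  have gD : gamma (D m) = phi (C m) by rewrite D_BC gamma_B T_T.
  by rewrite C_alpha gD.
have alpha_B m : alpha (B m) = B (theta (A m)).
  have <- : C (alpha (B m)) = theta (A m) by rewrite C_alpha_theta T_T.
  have -> : B (C (alpha (B m))) = D (alpha (B m)) by rewrite T_T.
  have D_alpha n : D (alpha n) = alpha (D n).
    have := T_one (alpha n); rewrite -{4}[n]T_one !linearD /= q_alpha A_alpha.
    by move/addrI.
  by rewrite D_alpha T_T.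
have rho_phi m : rho (phi m) = phi (rho m).
  by rewrite !phiE !linearD !linearZ /= rho_Y !rho_alpha.
have rho_theta m : rho (theta m) = theta (rho m).
  by rewrite !thetaE !linearB !linearZ /= !rho_alpha rho_phi.
have A_rho m : A (rho m) = rho m by rewrite rhoE T_T.
have rho_A m : rho (A m) = rho m by rewrite !rhoE T_T.
have [P PE] : exists P : {linear M -> M}, forall m,
    P m = q (p2 (q m)) + rho m + B (rho (C m)).
  by exists ((q \o p2 \o q) \+ rho \+ (B \o rho \o C)).
exists P; split=> [m|u uU|m|m|i m].
- by rewrite PE !rhoE !UD ?U_T.
- rewrite PE !rhoE !p2_id ?U_T // -[RHS]T_one; congr (_ + _ + _);
    rewrite !T_T //=.
  by rewrite T_T.
- rewrite !PE q_alpha p2_alpha q_alpha rho_alpha C_alpha_theta rho_theta.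
  by rewrite !linearD alpha_B A_rho.
- have gamma_D n : gamma (D n) = phi (C n).
    by have -> : D n = B (C n); rewrite ?gamma_B T_T.
  have -> : P (gamma m) = phi (rho (C m)) + B (Y (rho m)).
    rewrite PE q_gamma !linear0 add0r -rho_A A_gamma gamma_D rho_phi.
    by rewrite -YE rho_Y.
  have -> : gamma (P m) = gamma (rho m) + phi (rho (C m)).
    by rewrite PE !linearD gamma_q add0r gamma_B A_rho.
  rewrite addrC; congr (_ + _).
  by rewrite -{2}[rho m]A_rho -D_gamma YE T_T.
rewrite !inE => /or4P[|||/orP[]] /eqP->;
  rewrite !PE !rhoE !linearD !T_T //=.
all: rewrite ?linear0 ?add0r ?addr0 ?T_T //= ?linear0 ?add0r ?addr0 ?T_T //=.
Qed.

End Averaging.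

Lemma invariant_projection : exists P : {linear M -> M},
  [/\ forall m, P m \in U, forall u, u \in U -> P u = u,
      forall m, P (alpha m) = alpha (P m), forall m, P (gamma m) = gamma (P m) &
      forall i m, i \in [:: 1; 4; 5; 6; 7]%N -> P (T i m) = T i (P m)].
Proof.
pose Y : {linear M -> M} := C \o gamma.
pose e : {linear M -> M} :=
  2%:R^-1 \*: ((alpha \o alpha \o alpha \o Y) \+ (xi \*: (alpha \o Y))).
exact: (@averaged_projection Y (fun=> erefl) e (fun=> erefl)).
Qed.

End InvariantProjection.

(** * Semisimplicity and conclusion *)
Section Semisimplicity.
Variables (k : fieldType) (xi : k).
Hypotheses (xi_sqr : xi ^+ 2 = -1) (two_neq0 : 2%:R != 0 :> k).
Variables (K : hopf_alg k) (a b c d : K) (K_pres : is_calK xi a b c d).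
Notation e := (calK_basis a c).
Variable eps : nat -> {linear K -> k^o}.
Hypothesis eps_e :
  forall i j, (i < 8)%N -> (j < 8)%N -> eps i (e j) = (i == j)%:R.
Hypothesis eps_span :
  forall x, x = \sum_(i <- iota 0 8) (eps i x : k) *: e i.
Variables (M : yd_module K) (M_fin : fin_dim M).
Notation Y := (yd_str M).
Hypothesis no_trivial : forall m, coef eps Y 0 m = 0.

(** The complement is the kernel of an invariant projection: as [a] and [c]
    generate the algebra, that projection commutes with the whole action, and
    by [coact_coef] it is a comodule map. *)
Lemma yd_complement (U : {pred M}) : is_yd_sub Y U ->
  exists W : {pred M}, [/\ is_yd_sub Y W,
    forall m, m \in U -> m \in W -> m = 0 &
    forall m, exists u w, [/\ u \in U, w \in W & m = u + w]].
Proof.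
have M_yd := yd_axioms M.
move=> [U_sub U_act U_co].
pose T i : {linear M -> M} := HB.pack (coef eps Y i)
  (GRing.isLinear.Build k M M *:%R (coef eps Y i) (coef_is_linear eps M_yd i)).
have actL h : linear (act Y h) := (act_bilinear M_yd).2 h.
pose A h : {linear M -> M} :=
  HB.pack (act Y h) (GRing.isLinear.Build k M M *:%R (act Y h) (actL h)).
have U_T i m : m \in U -> T i m \in U.
  move=> /U_co[s sU m_co]; rewrite /= /coef m_co.
  rewrite tlift_sum_tens; last exact: scale_bilinear.
  case: U_sub => U0 Ul; rewrite big_seq.
  apply: (big_ind (fun y => y \in U)) => // [y z yU zU|p /sU pU].
    by rewrite -[y]scale1r Ul.
  by rewrite -[_ *: _]addr0 Ul.
have [P [P_U P_id P_a P_c P_T]] : exists P : {linear M -> M},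
  [/\ forall m, P m \in U, forall u, u \in U -> P u = u,
      forall m, P (A a m) = A a (P m), forall m, P (A c m) = A c (P m) &
      forall i m, i \in [:: 1; 4; 5; 6; 7]%N -> P (T i m) = T i (P m)].
  apply: (@invariant_projection k xi xi_sqr two_neq0 M M_fin T (A a) (A c))
    => //.
  - by move=> i j m i8 j8; apply: (coef_coef xi_sqr K_pres eps_e eps_span M_yd).
  - move=> m; have := coef_sum_one K_pres eps_span M_yd m.
    by rewrite no_trivial add0r.
  - exact: (action_order_a K_pres M_yd).
  - exact: (action_square_c K_pres M_yd).
  - exact: (action_a_c K_pres M_yd).
  - exact: (coef1_a xi_sqr K_pres eps_e eps_span M_yd no_trivial).
  - exact: (coef4_a xi_sqr K_pres eps_e eps_span M_yd no_trivial).
  - exact: (coef6_a xi_sqr K_pres eps_e eps_span M_yd no_trivial).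
  - exact: (coef1_c xi_sqr K_pres eps_e eps_span M_yd no_trivial).
  - exact: (action_c_coef1 xi_sqr K_pres eps_e eps_span M_yd no_trivial).
  - exact: (coef4_c xi_sqr K_pres eps_e eps_span M_yd no_trivial).
  - exact: (coef7_c xi_sqr K_pres eps_e eps_span M_yd no_trivial).
  - exact: (coef5_c xi_sqr K_pres eps_e eps_span M_yd no_trivial).
  - exact: (coef6_c xi_sqr K_pres eps_e eps_span M_yd no_trivial).
  - by move=> i m _; apply: U_T.
  - exact: (U_act a).
  - exact: (U_act c).
have P_act h m : P (act Y h m) = act Y h (P m).
  pose S := [pred x : K | `[< forall m, P (act Y x m) = act Y x (P m) >]].
  have S_alg : subalg_closed S.
    split=> [|x y z|y z].
    - by apply/asboolP => m'; rewrite !(act1 M_yd).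
    - move=> /asboolP yS /asboolP zS; apply/asboolP => m'.
      by rewrite !((act_bilinear M_yd).1 _ _ _ _) linearP yS zS.
    move=> /asboolP yS /asboolP zS; apply/asboolP => m'.
    by rewrite !(actM M_yd) yS zS.
  have aS : a \in S by apply/asboolP.
  have cS : c \in S by apply/asboolP.
  have [S1 _ SM] := S_alg.
  have S_monomial n n' : monomial a c n n' \in S.
    have SX x : x \in S -> forall i, x ^+ i \in S.
      by move=> xS; elim=> [|i IH]; rewrite ?expr0 // exprS SM.
    by rewrite SM ?SX.
  suff /asboolP : h \in S by apply.
  apply: (calK_gen K_pres S_alg) => x [] -> //.
    by rewrite (calK_b_monomial K_pres).
  by rewrite (calK_d_monomial K_pres).
pose W : {pred M} := [pred m | P m == 0].
have WE m : (m \in W) = (P m == 0) by [].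
exists W; split.
- split.
  + by split=> [|x m n]; rewrite !WE ?linear0 // linearP => /eqP-> /eqP->;
      rewrite scaler0 addr0.
  + by move=> h m; rewrite !WE P_act => /eqP->; rewrite -[act Y h 0]/(A h 0)
      linear0.
  move=> m; rewrite WE => /eqP Pm.
  exists [seq (e i, T i m) | i <- iota 0 8]; last first.
    by rewrite big_map /= (coact_coef eps_span).
  move=> _ /mapP[i i8 ->]; rewrite WE /=.
  have split8 : perm_eq (iota 0 8) ([:: 0; 2; 3] ++ [:: 1; 4; 5; 6; 7])%N by [].
  move: i8; rewrite (perm_mem split8) mem_cat => /orP[i023|iT]; last first.
    by rewrite -[coef _ _ _ _]/(T i m) P_T // Pm linear0.
  suff -> : coef eps Y i m = 0 by rewrite linear0.
  move: i023; rewrite !inE => /or3P[] /eqP-> //.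
    exact: (coef2 xi_sqr K_pres eps_e eps_span M_yd no_trivial _).
  exact: (coef3 xi_sqr K_pres eps_e eps_span M_yd no_trivial _).
- by move=> m /P_id Pm; rewrite WE Pm => /eqP.
move=> m; exists (P m), (m - P m); split=> //; last by rewrite addrC subrK.
by rewrite WE linearB (P_id (P m)) // subrr.
Qed.

Lemma indecomposable_yd_simple : yd_indecomposable M -> yd_simple M.
Proof.
move=> [M0 M_indec]; split=> // U U_yd.
have [W [W_yd UW M_sum]] := yd_complement U_yd.
have [U0|W0] := M_indec U W U_yd W_yd UW M_sum; first by left.
right=> m; have [u [w [uU wW ->]]] := M_sum m.
by move: wW; rewrite W0 inE => /eqP->; rewrite addr0 uU.
Qed.

End Semisimplicity.

Theorem theorem4p5 (k : closedFieldType) (char0 : [pchar k] =i pred0)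
  (xi : k) (xi_prim : 4.-primitive_root xi)
  (K : hopf_alg k) (a b c d : K) (K_pres : is_calK xi a b c d)
  (M : yd_module K) (M_fin : fin_dim M)
  (M_indec : yd_indecomposable M) (M_nonsimple : ~ yd_simple M)
  (B : braided_hopf K) (gr : nat -> {pred B})
  (B_nichols : is_nichols M gr) :
  ~ fin_dim B.
Proof.
have xi_sqr := primitive_root4_sqr xi_prim.
have [eps [eps_e eps_span]] :=
  dual_basis (calK_dim K_pres) (calK_basis_span xi_sqr K_pres).
have M_yd := yd_axioms M.
have two_neq0 : 2%:R != 0 :> k by move/pcharf0P: char0 => ->.
pose T := coef eps (yd_str M).
have T_T := coef_coef xi_sqr K_pres eps_e eps_span M_yd.
(* coef 0 is nonzero exactly when the trivial comodule is a composition factor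
   of M. *)
have [[m m0]|no_trivial] := pselect (exists m, T 0%N m <> 0); last first.
  case: M_nonsimple; apply: (indecomposable_yd_simple xi_sqr two_neq0 K_pres
    eps_e eps_span M_fin _ M_indec) => m.
  by apply: contrapT => m0; apply: no_trivial; exists m.
pose v := T 0%N m; pose w := T 2%N v.
have w_co : coact (yd_str M) w = calK_basis a c 1 \ox w.
  rewrite (coact_coef eps_span) !(big_cons, big_nil) /w /v /T !T_T //=.
  by rewrite !T_T //= !linear0r !add0r !addr0.
have v_co : coact (yd_str M) v = 1 \ox v + calK_basis a c 2 \ox w.
  rewrite (coact_coef eps_span) !(big_cons, big_nil) /w /v /T !T_T //=.
  by rewrite basis0 !linear0r !add0r !addr0.
apply: (nichols_infinite_of_coinvariant char0 B_nichols w_co v_co) => x v_eq.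
have : T 0%N v = 0.
  have coefL := coef_is_linear eps M_yd 0.
  rewrite v_eq -[x *: w]addr0 /T coefL (coef_zero eps M_yd) addr0 /w /v /T.
  by rewrite !T_T //= ?T_T //= scaler0.
by rewrite /v /T T_T.
Qed.
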